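(* There is a constant $C>0$ such that $$\Big||u|_{TV(\Omega)}-|u|_{DTV(\Omega)}\Big|\le C\,h\,\Big(\max_T|u|_{W^{2,\infty}(T)}+\sum_E\big\|[\![u]\!]'\big\|_{L^1(E)}\Big)$$ holds for all $u\in\mathcal{DG}_r(\Omega)$, $0\le r\le4$, where $h=\max_T h_T$ is the mesh size. The constant $C$ depends only on $r$, $s$, the maximal aspect ratio $\max_T\gamma_T$ and the area $|\Omega|$.
   Context: $\Omega\subset\mathbb R^2$ is a bounded domain with polygonal boundary, triangulated by a geometrically conforming mesh (no hanging nodes) of non-degenerate triangles $T$; $E$ ranges over the interior edges. On each interior edge $E$, $n_E$ is a fixed normal vector of unit Euclidean length with arbitrary orientation. $s\in[1,\infty]$ is fixed and $|\cdot|_s$ is the $\ell^s$-norm on $\mathbb R^2$. $h_T$ is the diameter (longest edge) of $T$, $\varrho_T$ the diameter of the largest inscribed circle, and $\gamma_T=h_T/\varrho_T$ the aspect ratio. $P_m(T)$ (resp. $P_m(E)$) denotes polynomials of total degree at most $m$ on $T$ (resp. univariate polynomials of degree at most $m$ on $E$); $P_{-1}=\{0\}$. $\mathcal{DG}_r(\Omega)=\{u\in L^2(\Omega): u|_T\in P_r(T)\text{ for all }T\}$, $r$ an integer. For an interior edge $E$ between $T_1,T_2$ with outer unit normals $n_1,n_2=-n_1$ along $E$, the scalar jump is $[\![u]\!]=(u|_{T_1}n_1+u|_{T_2}n_2)\cdot n_E\in P_r(E)$; the vector-valued jump is $[\![u]\!]\,n_E$. $[\![u]\!]'$ is the tangential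 derivative of $[\![u]\!]$ along $E$ (in an arbitrary direction of traversal). $|u|_{W^{2,\infty}(T)}=\max\{\max_T|u_{x_1x_1}|,\max_T|u_{x_1x_2}|,\max_T|u_{x_2x_2}|\}$. For $u\in\mathcal{DG}_r(\Omega)$, the total variation seminorm is $$|u|_{TV(\Omega)}=\sum_T\int_T|\nabla u|_s\,dx+\sum_E\int_E|[\![u]\!]|\,|n_E|_s\,dS$$ and the discrete total variation seminorm is $$|u|_{DTV(\Omega)}=\sum_T\int_T\mathcal I_T\{|\nabla u|_s\}\,dx+\sum_E\int_E\mathcal I_E\{|[\![u]\!]|\,|n_E|_s\}\,dS.$$ Here $\mathcal I_T\{v\}=\sum_i v(X_{T,i})\varphi_{T,i}$, where $\varphi_{T,i}$, $i=1,\dots,r(r+1)/2$, is the standard nodal (Lagrange) basis of $P_{r-1}(T)$ with nodes $X_{T,i}$ forming the uniform lattice on $T$ (for $P_0(T)$: the barycenter; for $r=0$ there are no triangle terms), and $\mathcal I_E\{v\}=\sum_j v(X_{E,j})\varphi_{E,j}$, where $\varphi_{E,j}$, $j=1,\dots,r+1$, is the standard nodal basis of $P_r(E)$ with equispaced nodes $X_{E,j}$ (including end points if $r\ge1$; the midpoint if $r=0$). *)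

(* Defs.v *)
From HB Require Import structures.
From mathcomp Require Import all_boot all_order all_algebra.
From mathcomp Require Import all_classical all_reals all_analysis.

Set Implicit Arguments.
Unset Strict Implicit.
Unset Printing Implicit Defensive.

Import Order.TTheory GRing.Theory Num.Theory.
Import numFieldNormedType.Exports.

Local Open Scope classical_set_scope.
Local Open Scope ring_scope.

Section Plane.
Context {R : realType}.
Implicit Types (v w x y : R * R) (s : \bar R).

Definition mu2 := (@lebesgue_measure R \x @lebesgue_measure R)%E.

Definition area (D : set (R * R)) : R := fine (mu2 D).

Definition dot v w : R := v.1 * w.1 + v.2 * w.2.

(* The norm of the library on R * R is the max norm. *)
Definition enorm v : R := Num.sqrt (dot v v).

(* The value at s = -oo is irrelevant, since s >= 1 is always assumed. *)
Definition snorm s v : R :=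
  match s with
  | p%:E => (`|v.1| `^ p + `|v.2| `^ p) `^ p^-1
  | +oo%E => Num.max `|v.1| `|v.2|
  | -oo%E => 0
  end.

Definition e1 : R * R := (1, 0).
Definition e2 : R * R := (0, 1).

Definition grad (f : R * R -> R) x : R * R := ('D_e1 f x, 'D_e2 f x).

(* p = \sum_(i, j) p`_i`_j x1^i x2^j is evaluated with x1 as outer variable. *)
Definition eval2 (p : {poly {poly R}}) x : R := p.[(x.1)%:P].[x.2].

Definition tdeg_le (m : nat) (p : {poly {poly R}}) : Prop :=
  forall i j : nat, (m < i + j)%N -> p`_i`_j = 0.

Definition segment v w : set (R * R) :=
  [set x | exists2 t : R, 0 <= t <= 1 & x = v + t *: (w - v)].

Definition boundary (D : set (R * R)) : set (R * R) := closure D `\` D°.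

Definition polygonal_domain (Omega : set (R * R)) : Prop :=
  [/\ open Omega, connected Omega, Omega !=set0, bounded_set Omega
    & exists S : seq ((R * R) * (R * R)),
        boundary Omega = [set x | exists2 c, c \in S & segment c.1 c.2 x]].

End Plane.

(* Triangles and edges are sets of vertex indices (with three and two elements
   respectively); [hull] turns them into closed subsets of the plane. *)
Record mesh (R : realType) := Mesh {
  nvtx : nat;
  vtx : 'I_nvtx -> R * R;
  cells : {set {set 'I_nvtx}} }.

Section Mesh.
Context {R : realType} (M : mesh R).
Implicit Types (A T E : {set 'I_(nvtx M)}) (Omega : set (R * R)).
Local Notation V := (@vtx R M).

Definition hull A : set (R * R) :=
  [set x | exists w : 'I_(nvtx M) -> R,
     [/\ forall i, 0 <= w i, forall i, i \notin A -> w i = 0,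
         \sum_i w i = 1 & x = \sum_i w i *: V i]].

Definition relint A : set (R * R) :=
  [set x | exists w : 'I_(nvtx M) -> R,
     [/\ forall i, i \in A -> 0 < w i, forall i, i \notin A -> w i = 0,
         \sum_i w i = 1 & x = \sum_i w i *: V i]].

Definition collinear A : Prop :=
  exists2 n : R * R, n != 0 &
    forall i j, i \in A -> j \in A -> dot n (V i - V j) = 0.

Definition is_edge E : Prop :=
  #|E| = 2%N /\ exists2 T, T \in cells M & E \subset T.

Definition interior_edge Omega E : Prop := is_edge E /\ relint E `<=` Omega.

(* The third clause says that two triangles meet in the hull of their common
   vertices: in a common edge, a common vertex, or not at all.  The last one is
   automatic when Omega is the interior of its closure; otherwise (domains with
   slits) it says that the boundary is resolved by edges of the mesh. *)
Definition triangulates Omega : Prop :=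
  [/\ forall T, T \in cells M -> #|T| = 3%N,
      forall T, T \in cells M -> ~ collinear T,
      forall T T', T \in cells M -> T' \in cells M ->
        hull T `&` hull T' = hull (T :&: T'),
      closure Omega = [set x | exists2 T, T \in cells M & hull T x]
    & forall x, boundary Omega x ->
        exists E, [/\ is_edge E, hull E x & hull E `<=` boundary Omega]].

Definition diam T : R :=
  \big[Num.max/0]_(i in T) \big[Num.max/0]_(j in T) enorm (V i - V j).

Definition inscribed_diam T : R :=
  sup [set 2 * rho | rho in [set rho : R | 0 <= rho /\
         exists c : R * R, forall y, enorm (y - c) <= rho -> hull T y]].

Definition aspect T : R := diam T / inscribed_diam T.

Definition max_aspect : R := \big[Num.max/0]_(T in cells M) aspect T.

Definition mesh_size : R := \big[Num.max/0]_(T in cells M) diam T.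

Definition edge_src E : R * R := nth 0 [seq V i | i <- enum E] 0.
Definition edge_tgt E : R * R := nth 0 [seq V i | i <- enum E] 1.

Definition edge_pt E (t : R) : R * R :=
  edge_src E + t *: (edge_tgt E - edge_src E).

Definition edge_length E : R := enorm (edge_tgt E - edge_src E).

Definition edge_tangent E : R * R :=
  (edge_length E)^-1 *: (edge_tgt E - edge_src E).

Definition edge_int E (f : R * R -> R) : R :=
  edge_length E *
  \int[@lebesgue_measure R]_(t in `[0, 1]%classic) f (edge_pt E t).

Definition tri_int T (f : R * R -> R) : R := \int[@mu2 R]_(x in hull T) f x.

Definition unit_normal E (n : R * R) : Prop :=
  enorm n = 1 /\ forall i j, i \in E -> j \in E -> dot n (V i - V j) = 0.

Definition outer_normal T E : R * R :=
  xget 0 [set n | unit_normal E n /\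
                  forall i j, i \in E -> j \in T -> dot n (V j - V i) <= 0].

(* Membership in P_m(T) and P_m(E) only constrains the values of a function of
   the plane on the triangle or edge. *)
Definition tri_poly (m : nat) T : set (R * R -> R) :=
  [set f | exists2 p : {poly {poly R}}, tdeg_le m p &
             forall x, hull T x -> f x = eval2 p x].

Definition edge_poly (m : nat) E : set (R * R -> R) :=
  [set f | exists2 q : {poly R}, (size q <= m.+1)%N &
             forall t : R, 0 <= t <= 1 -> f (edge_pt E t) = q.[t]].

(* The nodes of the uniform lattice of order m on the simplex A have barycentric
   coordinates a i / m, with a ranging over [lattice A m]. *)
Definition lattice A (m : nat) : pred {ffun 'I_(nvtx M) -> 'I_m.+1} :=
  [pred a : {ffun 'I_(nvtx M) -> 'I_m.+1} | [forall i, (i \notin A) ==> (a i == ord0)]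
            && (\sum_i (a i : nat) == m)%N].

Definition node A (m : nat) (a : {ffun 'I_(nvtx M) -> 'I_m.+1}) : R * R :=
  if m is 0 then (#|A|%:R)^-1 *: \sum_(i in A) V i
  else \sum_i ((a i : nat)%:R / m%:R) *: V i.

(* The nodal basis of P: the value 1 at its own node, 0 at the other ones. *)
Definition nodal_basis (P : set (R * R -> R)) A (m : nat)
    (a : {ffun 'I_(nvtx M) -> 'I_m.+1}) : R * R -> R :=
  xget (fun=> 0) [set f | P f /\
    forall b, lattice A b -> f (node A b) = (a == b)%:R].

Definition interp (P : set (R * R -> R)) A (m : nat) (v : R * R -> R) x : R :=
  \sum_(a | lattice A (m := m) a) v (node A a) * nodal_basis P A a x.

Definition interp_tri T m := interp (tri_poly m T) T m.
Definition interp_edge E m := interp (edge_poly m E) E m.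

(* Elements of L^2 are classes of functions: restrictions to triangles hold
   almost everywhere, and [restr] picks the polynomial representative of u|_T
   (unique as T has positive measure), which is what gradients, traces and nodal
   values refer to. *)
Definition restr_of (r : nat) (u : R * R -> R) T : set {poly {poly R}} :=
  [set p | tdeg_le r p /\ {ae @mu2 R, forall x, hull T x -> u x = eval2 p x}].

Definition DG Omega (r : nat) (u : R * R -> R) : Prop :=
  [/\ measurable_fun Omega u,
      (@mu2 R).-integrable Omega (fun x => (u x ^+ 2)%:E)
    & forall T, T \in cells M -> restr_of r u T !=set0].

Definition restr (r : nat) (u : R * R -> R) T : R * R -> R :=
  eval2 (xget 0 (restr_of r u T)).

(* The sum has one term for each of the two triangles adjacent to E. *)
Definition jump (nE : {set 'I_(nvtx M)} -> R * R) (r : nat) (u : R * R -> R)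
    E x : R :=
  dot (\sum_(T in cells M | E \subset T) restr r u T x *: outer_normal T E)
      (nE E).

Definition W2oo (f : R * R -> R) T : R :=
  Num.max (sup [set `|'D_e1 ('D_e1 f) x| | x in hull T])
  (Num.max (sup [set `|'D_e2 ('D_e1 f) x| | x in hull T])
           (sup [set `|'D_e2 ('D_e2 f) x| | x in hull T])).

Definition TV Omega (s : \bar R) nE (r : nat) (u : R * R -> R) : R :=
  \sum_(T in cells M) tri_int T (fun x => snorm s (grad (restr r u T) x))
  + \sum_(E | `[< interior_edge Omega E >])
      edge_int E (fun x => `|jump nE r u E x| * snorm s (nE E)).

(* I_T acts in P_(r-1)(T), hence no triangle terms for r = 0. *)
Definition DTV Omega (s : \bar R) nE (r : nat) (u : R * R -> R) : R :=
  (if r is m.+1 then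
     \sum_(T in cells M)
       tri_int T (interp_tri T m (fun x => snorm s (grad (restr r u T) x)))
   else 0)
  + \sum_(E | `[< interior_edge Omega E >])
      edge_int E
        (interp_edge E r (fun x => `|jump nE r u E x| * snorm s (nE E))).

Definition max_W2oo (r : nat) (u : R * R -> R) : R :=
  \big[Num.max/0]_(T in cells M) W2oo (restr r u T) T.

Definition jump_deriv_L1 nE (r : nat) (u : R * R -> R) E : R :=
  edge_int E (fun x => `|'D_(edge_tangent E) (jump nE r u E) x|).

End Mesh.

(* Main.v *)
Require Import Defs.
From HB Require Import structures.
From mathcomp Require Import all_boot all_order all_algebra.
From mathcomp Require Import all_classical all_reals all_analysis.
From mathcomp Require Import measurable_realfun.
From mathcomp Require Import ring lra zify.
Import Order.TTheory GRing.Theory Num.Theory numFieldNormedType.Exports.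
Local Open Scope classical_set_scope.
Local Open Scope ring_scope.
Set Implicit Arguments.
Unset Strict Implicit.
Unset Printing Implicit Defensive.

(** The discrete seminorm replaces every integrand v by its Lagrange interpolant
    on the triangle or edge, so the two seminorms differ by a sum of local
    interpolation errors, and a first-order estimate of each one is enough.

    Lagrange interpolation reproduces constants, hence on a triangle or edge A

      |I v (x) - v x| <= Lambda * sup_(y in A) |v y - v x|,

    where Lambda bounds the sum of the absolute values of the nodal basis.  It
    depends on the degree only: in barycentric coordinates w the nodal basis of
    the uniform lattice of order m is given by the formula of Silvester
    prod_i prod_(l < a_i) (m w_i - l) / (a_i - l), a product of m factors bounded
    by m, whatever the shape of A.  This is [interp_dist].  To apply it, the
    nodal basis has to be identified with the formula of Silvester, that is, the
    lattice has to be unisolvent for P_m(T) and P_m(E).  Instead of counting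
    dimensions, [degree_reproduced] shows that every product of at most m affine
    functions equals the combination of Silvester polynomials with its own nodal
    values; a function in P_m that satisfies the nodal conditions is then the
    Silvester polynomial.

    On a triangle, v = |grad u|_s.  The s-norm is 1-Lipschitz in each coordinate
    ([snorm_lipschitz], from the convexity of powers), and grad u is Lipschitz
    with constant given by the second derivatives of u, so that v oscillates by
    at most 4 h |u|_(W^(2,oo)(T)).  Integration gives the factor |T|
    ([tri_error]), and the areas add up to at most |Omega|, because triangles
    overlap, and leave Omega, only along segments, which are null sets
    ([sum_area_le]).

    On an edge, v is |J| times |n_E|_s <= 2, where J is the jump, the restriction
    to E of a polynomial.  By the fundamental theorem of calculus J oscillates by
    at most the L^1 norm of its derivative ([line_variation]), and integration
    gives the factor |E| <= h ([edge_error]). *)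

(** * Lagrange interpolation in barycentric coordinates *)

Section Silvester.
Context {R : realType} {M : mesh R}.
Local Notation n := (nvtx M).
Local Notation V := (@vtx R M).
Implicit Types (A : {set 'I_n}) (w : 'I_n -> R).

Definition weights A w : Prop :=
  [/\ forall i, 0 <= w i, forall i, i \notin A -> w i = 0 & \sum_i w i = 1].

Definition bary w : R * R := \sum_i w i *: V i.

Lemma hullP A x : hull A x <-> exists2 w, weights A w & x = bary w.
Proof.
split=> [[w [w0 wA w1 ->]]|[w [w0 wA w1] ->]]; exists w => //; by split.
Qed.

Lemma weights_le1 A w i : weights A w -> w i <= 1.
Proof.
by case=> w0 _ <-; rewrite (bigD1 i)//= lerDl; apply: sumr_ge0.
Qed.

Variable m : nat.
Local Notation idx := {ffun 'I_n -> 'I_m.+1}.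

(** Barycentric coordinates of the lattice nodes.  For m = 0 the only node is the
    barycenter, where the general formula would divide by zero. *)
Definition node_weights A (b : idx) : 'I_n -> R := fun i =>
  if m is 0 then (i \in A)%:R / #|A|%:R else (b i : nat)%:R / m%:R.

(** The numerator of the Silvester polynomial.  The recurrences in a below take
    their simplest form without the normalization. *)
Definition falling (a : 'I_n -> nat) w : R :=
  \prod_i \prod_(l < a i) (m%:R * w i - l%:R).

(** The i-th factor is the binomial coefficient of m w_i over a_i, as a polynomial
    in w_i. *)
Definition silvester (a : 'I_n -> nat) w : R :=
  \prod_i \prod_(l < a i) ((m%:R * w i - l%:R) / ((a i)%:R - l%:R)).

Definition index_incr (a : 'I_n -> nat) i : 'I_n -> nat :=
  fun j => (a j + (i == j))%N.
Arguments index_incr : simpl never.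

Lemma latticeP A (a : idx) :
  reflect ((forall i, i \notin A -> a i = ord0) /\ (\sum_i (a i : nat))%N = m)
          (lattice A a).
Proof.
apply: (iffP andP) => [[/forallP h /eqP]|[h s]].
  by split=> // i iA; apply/eqP; exact: (implyP (h i)).
by split; [apply/forallP => i; apply/implyP => /h ->|apply/eqP].
Qed.

Lemma node_bary A (b : idx) : node A b = bary (node_weights A b).
Proof.
rewrite /node /bary /node_weights; case: m b => [|k] b //.
rewrite scaler_sumr big_mkcond; apply: eq_bigr => i _.
by case: (i \in A); rewrite ?mul1r// mul0r scale0r.
Qed.

Lemma node_weightsP A (b : idx) : (0 < #|A|)%N -> lattice A b ->
  weights A (node_weights A b).
Proof.
move=> A0 /latticeP[bA bm]; rewrite /node_weights.
case: m b bA bm => [|k] b bA bm; split.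
- by move=> i; rewrite divr_ge0.
- by move=> i /negbTE ->; rewrite mul0r.
- rewrite -mulr_suml -natr_sum.
  have -> : (\sum_i (i \in A) = #|A|)%N by rewrite -sum1_card [RHS]big_mkcond.
  by rewrite divff// pnatr_eq0 -lt0n.
- by move=> i; rewrite divr_ge0.
- by move=> i /bA ->; rewrite mul0r.
- by rewrite -mulr_suml -natr_sum bm divff// pnatr_eq0.
Qed.

Lemma node_weightsM A (b : idx) i : lattice A b -> (0 < m)%N ->
  m%:R * node_weights A b i = (b i : nat)%:R.
Proof.
rewrite /node_weights; case: m b => [//|k] b _ _.
by rewrite mulrC divfK// pnatr_eq0.
Qed.

Lemma falling_incr a i w :
  falling (index_incr a i) w = falling a w * (m%:R * w i - (a i)%:R).
Proof.
have Ei : index_incr a i i = (a i).+1 by rewrite /index_incr eqxx addn1.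
have Ej j : j != i -> index_incr a i j = a j.
  by rewrite /index_incr eq_sym => /negbTE ->; rewrite addn0.
rewrite /falling (bigD1 i)//= [in RHS](bigD1 i)//= Ei big_ord_recr /=.
rewrite (eq_bigr (fun j => \prod_(l < a j) (m%:R * w j - l%:R))) => [|j /Ej -> //].
by rewrite mulrAC.
Qed.

(** Since the weights add up to 1, multiplying by m - |a| amounts to adding the
    factors m w_i - a_i.  This raises the degree of a falling product by one. *)
Lemma sum_falling_incr A a w : weights A w -> (forall i, i \notin A -> a i = 0%N) ->
  \sum_(i in A) falling (index_incr a i) w =
  (m%:R - (\sum_i a i)%N%:R) * falling a w.
Proof.
move=> [_ wA w1] aA.
rewrite (eq_bigr _ (fun i _ => falling_incr a i w)).
rewrite -mulr_sumr mulrC; congr (_ * _).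
have mw : m%:R = \sum_i m%:R * w i by rewrite -mulr_sumr w1 mulr1.
rewrite [X in _ = X - _]mw natr_sum -sumrB big_mkcond/=.
by apply: eq_bigr => i _; case: ifPn => // iA; rewrite wA// aA// mulr0 subr0.
Qed.

(** At the node b the factors are the binomial coefficients of b_i over a_i.  As a
    and b have the same sum, either they coincide or a_i > b_i for some i, and
    then the i-th factor vanishes. *)
Lemma silvester_node A (a b : idx) : lattice A a -> lattice A b ->
  silvester (fun i => a i) (node_weights A b) = (a == b)%:R.
Proof.
move=> la lb; have /latticeP[aA am] := la; have /latticeP[bA bm] := lb.
case: (posnP m) => [m0|m0].
  have a0 i : a i = 0%N :> nat by have := ltn_ord (a i); lia.
  have b0 i : b i = 0%N :> nat by have := ltn_ord (b i); lia.
  have -> : a = b by apply/ffunP => i; apply: val_inj; rewrite /= a0 b0.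
  by rewrite eqxx /silvester big1// => i _; rewrite b0 big_ord0.
rewrite /silvester; case: eqVneq => [ab|ab].
  rewrite big1// => i _; rewrite big1// => l _.
  rewrite (node_weightsM _ lb m0) -ab divff// subr_eq0 eqr_nat gtn_eqF//.
have /existsP[i ilt] : [exists i, (b i < a i)%N].
  apply: contraT; rewrite negb_exists => /forallP h; case/eqP: ab.
  have le i : (a i <= b i)%N by rewrite leqNgt.
  have sub0 : (\sum_i (b i - a i) = 0)%N.
    by rewrite sumnB ?am ?bm ?subnn// => i _.
  apply/ffunP => i; apply: val_inj; apply/eqP; rewrite eqn_leq le/= -subn_eq0.
  by move/eqP: sub0; rewrite sum_nat_eq0 => /forallP/(_ i).
by rewrite (bigD1 i)//= (bigD1 (Ordinal ilt))//= (node_weightsM _ lb m0) subrr !mul0r.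
Qed.

(** There are m factors; the numerators are at most m and the denominators at
    least 1 in absolute value. *)
Lemma silvester_le (a : 'I_n -> nat) A w :
  weights A w -> (\sum_i a i)%N = m -> `|silvester a w| <= (m ^ m)%N%:R.
Proof.
move=> wP am.
have {2}-> : m = (\sum_(i < n) \sum_(l < a i) 1)%N.
  by rewrite -[LHS]am; apply: eq_bigr => i _; rewrite sum1_card card_ord.
rewrite expn_sum natr_prod /silvester normr_prod; apply: ler_prod => i _.
rewrite normr_ge0/= expn_sum natr_prod normr_prod; apply: ler_prod => l _.
rewrite normr_ge0/= expn1 normrM normfV.
have aim : (a i <= m)%N by rewrite -am (bigD1 i)//= leq_addr.
have lm : (l%:R : R) <= m%:R by rewrite ler_nat (leq_trans (ltnW (ltn_ord l))).
have la : (l.+1%:R : R) <= (a i)%:R by rewrite ler_nat.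
have [w0 _ _] := wP; have w1 := weights_le1 i wP; have wi0 := w0 i.
have m0 : (0 : R) <= m%:R by [].
have l0 : (0 : R) <= l%:R by [].
have mw : m%:R * w i <= m%:R by rewrite ler_piMr.
have mw0 : 0 <= m%:R * w i by rewrite mulr_ge0.
have d1 : 1 <= `|(a i)%:R - l%:R : R|.
  by rewrite ger0_norm; move: la; rewrite -natr1; lra.
rewrite -[leRHS]mulr1; apply: ler_pM => //.
- by rewrite ler_norml; apply/andP; split; lra.
- by rewrite invf_le1//; exact: lt_le_trans d1.
Qed.

Section Reproduction.
Variable A : {set 'I_n}.
Hypothesis A0 : (0 < #|A|)%N.

(** Exactness of interpolation at the lattice nodes, with the Silvester polynomials
    in place of the nodal basis.  The condition is linear in F, which makes
    unisolvence provable without any dimension count. *)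
Definition reproduced (F : ('I_n -> R) -> R) : Prop :=
  forall w, weights A w ->
    F w = \sum_(a : idx | lattice A a)
            F (node_weights A a) * silvester (fun i => a i) w.

Lemma eq_reproduced F G : (forall w, weights A w -> F w = G w) ->
  reproduced F -> reproduced G.
Proof.
move=> FG rF w wP; rewrite -FG// rF//; apply: eq_bigr => a la.
by rewrite FG//; exact: node_weightsP.
Qed.

Lemma reproducedZ c F : reproduced F -> reproduced (fun w => c * F w).
Proof.
by move=> rF w wP; rewrite rF// mulr_sumr; apply: eq_bigr => a _; rewrite mulrA.
Qed.

Lemma reproduced_sum (I : Type) (s : seq I) (P : pred I)
    (F : I -> ('I_n -> R) -> R) :
  (forall i, P i -> reproduced (F i)) -> reproduced (fun w => \sum_(i <- s | P i) F i w).
Proof.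
move=> rF w wP; under eq_bigr => i Pi do rewrite (rF i Pi w wP).
by rewrite exchange_big/=; apply: eq_bigr => a _; rewrite mulr_suml.
Qed.

Lemma reproducedD F G : reproduced F -> reproduced G ->
  reproduced (fun w => F w + G w).
Proof.
move=> rF rG w wP; rewrite rF// rG// -big_split/=.
by apply: eq_bigr => a _; rewrite mulrDl.
Qed.

Lemma falling_silvester (a : idx) w : lattice A a ->
  falling (fun i => a i) w =
  (\prod_i \prod_(l < a i) ((a i)%:R - l%:R)) * silvester (fun i => a i) w.
Proof.
move=> la; rewrite /falling /silvester -big_split/=; apply: eq_bigr => i _.
rewrite -big_split/=; apply: eq_bigr => l _.
by rewrite [RHS]mulrC divfK// subr_eq0 eqr_nat gtn_eqF.
Qed.

Lemma reproduced_falling_top (a : idx) : lattice A a ->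
  reproduced (falling (fun i => a i)).
Proof.
move=> la w wP; rewrite (bigD1 a)//= big1 => [|b /andP[lb ba]].
  by rewrite !falling_silvester// (silvester_node la la) eqxx mulr1 addr0.
by rewrite falling_silvester// (silvester_node la lb) eq_sym (negbTE ba) mulr0 mul0r.
Qed.

(** Downward induction on the degree |a| = m - k: for k = 0 the falling product is
    a multiple of a Silvester polynomial, and otherwise it is a combination of
    falling products of the next degree. *)
Lemma reproduced_falling k (a : 'I_n -> nat) :
  (forall i, i \notin A -> a i = 0%N) -> (\sum_i a i + k)%N = m ->
  reproduced (falling a).
Proof.
elim: k a => [|k IH] a aA am.
  rewrite addn0 in am.
  have aim i : (a i < m.+1)%N by rewrite ltnS -am (bigD1 i)//= leq_addr.
  pose b : idx := [ffun i => Ordinal (aim i)].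
  have bE : (fun i => b i : nat) = a by apply/funext => i; rewrite ffunE.
  rewrite -bE; apply: reproduced_falling_top; apply/latticeP; split.
    by move=> i iA; apply: val_inj; rewrite ffunE/= aA.
  by rewrite -[RHS]am; apply: eq_bigr => i _; rewrite ffunE.
apply: (@eq_reproduced
  (fun w => k.+1%:R^-1 * \sum_(i in A) falling (index_incr a i) w)).
  move=> w wP; rewrite (sum_falling_incr wP)//.
  by rewrite -am natrD addrAC subrr add0r mulKf// pnatr_eq0.
apply/reproducedZ/reproduced_sum => i iA; apply: IH.
  move=> j jA; rewrite /index_incr aA//; case: eqVneq => // ij.
  by rewrite -ij iA in jA.
rewrite -am /index_incr big_split/= -addnA; congr (_ + _)%N.
by rewrite (bigD1 i)//= eqxx big1 ?addn0// => j; rewrite eq_sym => /negbTE ->.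
Qed.

Lemma sum_silvester w : weights A w ->
  \sum_(a : idx | lattice A a) silvester (fun i => a i) w = 1.
Proof.
move=> wP; have falling0 w' : falling (fun=> 0%N) w' = 1.
  by rewrite /falling big1// => i _; rewrite big_ord0.
have rep : reproduced (falling (fun=> 0%N)).
  by apply: (@reproduced_falling m) => //; rewrite big1.
by rewrite -[RHS](falling0 w) rep//; apply: eq_bigr => a _; rewrite falling0 mul1r.
Qed.

(** The products with all falling products of complementary degree are required
    to be reproduced, and not only F itself: in this form the property is stable
    under multiplication by a weight, at the price of one degree. *)
Definition degree_at_most k (F : ('I_n -> R) -> R) : Prop :=
  forall a : 'I_n -> nat, (forall i, i \notin A -> a i = 0%N) ->
    (\sum_i a i + k <= m)%N -> reproduced (fun w => F w * falling a w).

Lemma degree_reproduced k F : (k <= m)%N -> degree_at_most k F -> reproduced F.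
Proof.
move=> km /(_ (fun=> 0%N)) h.
apply: (@eq_reproduced (fun w => F w * falling (fun=> 0%N) w)).
  move=> w _; rewrite /falling big1 ?mulr1// => i _; by rewrite big_ord0.
by apply: h => //; rewrite big1.
Qed.

Lemma degree_le k k' F : (k <= k')%N -> degree_at_most k F -> degree_at_most k' F.
Proof. by move=> kk h a aA am; apply: h => //; lia. Qed.

Lemma eq_degree k F G : (forall w, weights A w -> F w = G w) ->
  degree_at_most k F -> degree_at_most k G.
Proof.
move=> FG h a aA am; apply: (@eq_reproduced (fun w => F w * falling a w)).
  by move=> w wP; rewrite FG.
exact: h.
Qed.

Lemma degree1 : degree_at_most 0 (fun=> 1).
Proof.
move=> a aA; rewrite addn0 => am; apply: (@eq_reproduced (falling a)).
  by move=> w _; rewrite mul1r.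
by apply: (@reproduced_falling (m - \sum_i a i)) => //; lia.
Qed.

Lemma degreeZ k c F : degree_at_most k F -> degree_at_most k (fun w => c * F w).
Proof.
move=> h a aA am; apply: (@eq_reproduced (fun w => c * (F w * falling a w))).
  by move=> w _; rewrite mulrA.
exact/reproducedZ/h.
Qed.

Lemma degree_sum k (I : Type) (s : seq I) (P : pred I)
    (F : I -> ('I_n -> R) -> R) :
  (forall i, P i -> degree_at_most k (F i)) ->
  degree_at_most k (fun w => \sum_(i <- s | P i) F i w).
Proof.
move=> h a aA am.
apply: (@eq_reproduced (fun w => \sum_(i <- s | P i) (F i w * falling a w))).
  by move=> w _; rewrite mulr_suml.
by apply: reproduced_sum => i Pi; exact: h.
Qed.

(** The product of m w_i with the falling product of a is the falling product of
    a + e_i plus a_i times the one of a. *)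
Lemma degree_weight k i F : degree_at_most k F ->
  degree_at_most k.+1 (fun w => w i * F w).
Proof.
move=> h a aA am; case: (boolP (i \in A)) => iA; last first.
  apply: (@eq_reproduced (fun w => 0 * (F w * falling a w))).
    by move=> w [_ wA _]; rewrite wA// !mul0r.
  by apply/reproducedZ/h => //; lia.
have m0 : (0 < m)%N by lia.
apply: (@eq_reproduced (fun w => m%:R^-1 * (F w * falling (index_incr a i) w +
                                  (a i)%:R * (F w * falling a w)))).
  move=> w _; rewrite falling_incr.
  have mn0 : m%:R != 0 :> R by rewrite pnatr_eq0; lia.
  by field.
apply/reproducedZ/reproducedD; [apply: h|apply/reproducedZ/h => //; lia].
  move=> j jA; rewrite /index_incr aA//; case: eqVneq => // ij.
  by rewrite -ij iA in jA.
suff -> : (\sum_j index_incr a i j = (\sum_j a j).+1)%N by lia.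
rewrite /index_incr big_split/= -addn1; congr (_ + _)%N.
by rewrite (bigD1 i)//= eqxx big1 ?addn0// => j; rewrite eq_sym => /negbTE ->.
Qed.

Lemma degree_affine k (c : 'I_n -> R) F : degree_at_most k F ->
  degree_at_most k.+1 (fun w => (\sum_i w i * c i) * F w).
Proof.
move=> h; apply: (@eq_degree _ (fun w => \sum_i c i * (w i * F w))).
  by move=> w _; rewrite mulr_suml; apply: eq_bigr => i _; ring.
by apply: degree_sum => i _; apply/degreeZ/degree_weight.
Qed.

Lemma degree_affineX k l (c : 'I_n -> R) F : degree_at_most k F ->
  degree_at_most (l + k) (fun w => (\sum_i w i * c i) ^+ l * F w).
Proof.
move=> h; elim: l => [|l IH].
  by apply: eq_degree h => w _; rewrite expr0 mul1r.
by apply: eq_degree (degree_affine c IH) => w _; rewrite exprS mulrA.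
Qed.

Section NodalBasis.
Variable P : set (R * R -> R).
Hypothesis P_reproduced : forall f, P f -> reproduced (f \o bary).
Hypothesis P_silvester : forall a : idx, lattice A a ->
  exists2 f, P f & forall w, weights A w -> f (bary w) = silvester (fun i => a i) w.

(** A member of P is determined by its nodal values because it is reproduced, and
    the second hypothesis supplies a member with the nodal values wanted. *)
Lemma nodal_basisE (a : idx) w : lattice A a -> weights A w ->
  nodal_basis P A a (bary w) = silvester (fun i => a i) w.
Proof.
move=> la wP; rewrite /nodal_basis; case: xgetP => [f _ [Pf fd]|abs].
  rewrite [LHS](P_reproduced Pf wP) (bigD1 a)//= big1 => [|b /andP[lb ba]].
    by rewrite -node_bary fd// eqxx mul1r addr0.
  by rewrite -node_bary fd// eq_sym (negbTE ba) mul0r.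
have [f Pf fs] := P_silvester la; exfalso; apply: (abs f); split=> // b lb.
by rewrite node_bary fs ?silvester_node//; exact: node_weightsP.
Qed.

Lemma interpE v w : weights A w -> interp P A m v (bary w) =
  \sum_(a : idx | lattice A a) v (node A a) * silvester (fun i => a i) w.
Proof.
by move=> wP; apply: eq_bigr => a la; rewrite nodal_basisE.
Qed.

(** A lattice index is determined by its values on A: the bound does not depend on
    the number of vertices of the mesh. *)
Lemma card_lattice : (#|[pred a : idx | lattice A a]| <= m.+1 ^ #|A|)%N.
Proof.
rewrite -[X in (X ^ _)%N]card_ord -(card_pffun_on (ord0 : 'I_m.+1) A predT).
apply: subset_leq_card; apply/fintype.subsetP => a; rewrite inE => /latticeP[aA _].
apply/pffun_onP; split=> // ; apply/fintype.subsetP => i; rewrite inE => h.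
by apply: contraNT h => /aA ->.
Qed.

(** The interpolant of the constant v x is v x itself, so the error at x is the
    interpolant of v - v x. *)
Lemma interp_dist v (x : R * R) (d : R) : hull A x ->
  (forall y, hull A y -> `|v y - v x| <= d) ->
  `|interp P A m v x - v x| <= (m.+1 ^ #|A| * m ^ m)%N%:R * d.
Proof.
move=> /hullP[w wP ->] vd.
have d0 : 0 <= d.
  by apply: le_trans (vd (bary w) _) => //; apply/hullP; exists w.
have vE : v (bary w) = \sum_(a : idx | lattice A a)
    v (bary w) * silvester (fun i => a i) w.
  by rewrite -mulr_sumr sum_silvester// mulr1.
rewrite interpE// [X in _ - X]vE -sumrB.
apply: le_trans (ler_norm_sum _ _ _) _.
apply: (@le_trans _ _ (\sum_(a : idx | lattice A a) (m ^ m)%N%:R * d)).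
  apply: ler_sum => a la; rewrite -mulrBl normrM mulrC.
  apply: ler_pM => //; last first.
    apply: vd; rewrite node_bary; apply/hullP; eexists; last reflexivity.
    exact: node_weightsP.
  by apply: silvester_le wP _; case/latticeP: la.
rewrite sumr_const -[leLHS]mulr_natl natrM -mulrA ler_wpM2r ?mulr_ge0//.
by rewrite ler_nat; exact: card_lattice.
Qed.

End NodalBasis.
End Reproduction.
End Silvester.

(** * Bivariate polynomials and the polynomial spaces on triangles and edges *)

Section BivariatePolynomials.
Context {R : realType}.
Implicit Types (p q : {poly {poly R}}) (x v : R * R).

Lemma eval2D p q x : eval2 (p + q) x = eval2 p x + eval2 q x.
Proof. by rewrite /eval2 !hornerD. Qed.

Lemma eval2M p q x : eval2 (p * q) x = eval2 p x * eval2 q x.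
Proof. by rewrite /eval2 !hornerM. Qed.

Lemma eval2C (c : R) x : eval2 c%:P%:P x = c.
Proof. by rewrite /eval2 !hornerC. Qed.

Lemma eval2_prod (I : Type) (s : seq I) (P : pred I) (F : I -> {poly {poly R}}) x :
  eval2 (\prod_(i <- s | P i) F i) x = \prod_(i <- s | P i) eval2 (F i) x.
Proof.
rewrite (big_morph (fun p => eval2 p x) (fun p q => eval2M p q x) (id1 := 1))//.
by rewrite /eval2 !hornerC.
Qed.

Lemma eval2_sum (I : Type) (s : seq I) (P : pred I) (F : I -> {poly {poly R}}) x :
  eval2 (\sum_(i <- s | P i) F i) x = \sum_(i <- s | P i) eval2 (F i) x.
Proof.
rewrite (big_morph (fun p => eval2 p x) (fun p q => eval2D p q x) (id1 := 0))//.
by rewrite /eval2 !horner0.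
Qed.

Lemma eval2_coef p x :
  eval2 p x = \sum_(i < size p) \sum_(j < size p`_i) p`_i`_j * (x.1 ^+ i * x.2 ^+ j).
Proof.
rewrite /eval2 [p.[_]]horner_coef horner_sum; apply: eq_bigr => i _.
rewrite hornerM -polyC_exp hornerC horner_coef mulr_suml.
by apply: eq_bigr => j _; ring.
Qed.

Lemma tdeg_leC (c : R) : tdeg_le 0 (c%:P%:P : {poly {poly R}}).
Proof.
move=> i j ij; rewrite coefC; case: eqVneq => [i0|_]; last by rewrite coef0.
by rewrite coefC; case: eqVneq => [j0|//]; move: ij; rewrite i0 j0.
Qed.

Lemma tdeg_le_trans m m' p : (m <= m')%N -> tdeg_le m p -> tdeg_le m' p.
Proof. by move=> mm h i j ij; apply: h; exact: leq_ltn_trans ij. Qed.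

Lemma tdeg_leD m p q : tdeg_le m p -> tdeg_le m q -> tdeg_le m (p + q).
Proof. by move=> hp hq i j ij; rewrite !coefD hp// hq// addr0. Qed.

Lemma tdeg_leM m m' p q : tdeg_le m p -> tdeg_le m' q -> tdeg_le (m + m') (p * q).
Proof.
move=> hp hq i j ij; rewrite coefM coef_sum big1// => k _.
rewrite coefM big1// => l _.
have := ltn_ord k; have := ltn_ord l; rewrite !ltnS => lj ki.
have [h|h] := ltnP m (k + l)%N; first by rewrite hp// mul0r.
by rewrite hq ?mulr0//; lia.
Qed.

Lemma tdeg_le_prod (I : Type) (s : seq I) (d : I -> nat) (F : I -> {poly {poly R}}) :
  (forall i, tdeg_le (d i) (F i)) ->
  tdeg_le (\sum_(i <- s) d i) (\prod_(i <- s) F i).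
Proof.
move=> h; elim/big_rec2: _ => [|i m p _ hp]; first exact: tdeg_leC.
exact: tdeg_leM.
Qed.

(** The polynomial c + a x1 + b x2; the variable x1 is the outer one. *)
Definition affine_poly (c a b : R) : {poly {poly R}} :=
  c%:P%:P + a%:P%:P * 'X + b%:P%:P * ('X)%:P.

Lemma eval2_affine c a b x : eval2 (affine_poly c a b) x = c + a * x.1 + b * x.2.
Proof. by rewrite !eval2D !eval2M !eval2C /eval2 hornerX !hornerC hornerX. Qed.

Lemma tdeg_le_affine c a b : tdeg_le 1 (affine_poly c a b).
Proof.
have hX : tdeg_le 1 ('X : {poly {poly R}}).
  move=> i j ij; rewrite coefX; case: eqVneq => [i1|_]; last by rewrite coef0.
  by rewrite coefC; case: eqVneq => [j0|//]; move: ij; rewrite i1 j0.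
have hY : tdeg_le 1 (('X)%:P : {poly {poly R}}).
  move=> i j ij; rewrite coefC; case: eqVneq => [i0|_]; last by rewrite coef0.
  by rewrite coefX; case: eqVneq => [j1|//]; move: ij; rewrite i0 j1.
apply: tdeg_leD; first apply: tdeg_leD.
- exact: tdeg_le_trans (tdeg_leC c).
- exact: tdeg_leM (tdeg_leC a) hX.
- exact: tdeg_leM (tdeg_leC b) hY.
Qed.

End BivariatePolynomials.

Section Elements.
Context {R : realType} {M : mesh R}.
Local Notation n := (nvtx M).
Local Notation V := (@vtx R M).
Implicit Types (A T E : {set 'I_n}) (w : 'I_n -> R).

Definition cross (u v : R * R) : R := u.1 * v.2 - u.2 * v.1.

Lemma sum_support (U : nmodType) A (F : 'I_n -> U) :
  (forall i, i \notin A -> F i = 0) -> \sum_i F i = \sum_(i <- enum A) F i.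
Proof.
move=> FA; rewrite big_enum/= [RHS]big_mkcond/=.
by apply: eq_bigr => i _; case: ifPn => // /FA.
Qed.

Lemma bary_support A w : weights A w -> bary w = \sum_(i <- enum A) w i *: V i.
Proof.
by case=> _ wA _; apply: sum_support => i /wA ->; rewrite scale0r.
Qed.

Lemma fst_sum (I : Type) (s : seq I) (P : pred I) (F : I -> R * R) :
  (\sum_(i <- s | P i) F i).1 = \sum_(i <- s | P i) (F i).1.
Proof. exact: (big_morph fst (fun _ _ => erefl) erefl). Qed.

Lemma snd_sum (I : Type) (s : seq I) (P : pred I) (F : I -> R * R) :
  (\sum_(i <- s | P i) F i).2 = \sum_(i <- s | P i) (F i).2.
Proof. exact: (big_morph snd (fun _ _ => erefl) erefl). Qed.

Lemma bary1 w : (bary w).1 = \sum_i w i * (V i).1.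
Proof. by rewrite fst_sum. Qed.

Lemma bary2 w : (bary w).2 = \sum_i w i * (V i).2.
Proof. by rewrite snd_sum. Qed.

Lemma perp_neq0 (u : R * R) : u != 0 -> (- u.2, u.1) != 0.
Proof.
case: u => u1 u2; apply: contraNN => /eqP[h1 ->].
by apply/eqP; congr pair; rewrite -[LHS]opprK h1 oppr0.
Qed.

(** If the cross product vanishes, the normal of one of the two sides at the first
    vertex (or any vector, if all the vertices coincide) witnesses collinearity. *)
Lemma triangle_enum T : #|T| = 3%N -> ~ collinear T ->
  exists a b c, [/\ enum T = [:: a; b; c], uniq [:: a; b; c] &
    cross (V b - V a) (V c - V a) != 0].
Proof.
move=> T3 ncT; have := enum_uniq T; have := cardE T; rewrite T3.
have memT i : (i \in T) = (i \in enum T) by rewrite mem_enum.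
case: (enum T) memT => [|a [|b [|c []]]]// memT _ u.
exists a, b, c; split=> //; apply: contra_notN ncT => /eqP D0.
have key (m : R * R) : m != 0 -> dot m (V b - V a) = 0 -> dot m (V c - V a) = 0 ->
    collinear T.
  move=> m0 mb mc; exists m => //.
  have ka i : i \in T -> dot m (V i) = dot m (V a).
    rewrite memT !inE; move: mb mc; rewrite /dot/= => mb mc.
    by case/or3P => /eqP ->; lra.
  by move=> i j /ka hi /ka hj; move: hi hj; rewrite /dot/= => *; lra.
move: D0; rewrite /cross => D0.
have [b0|b0] := eqVneq (V b - V a) 0; last first.
  apply: (key (- (V b - V a).2, (V b - V a).1)).
  - exact: perp_neq0.
  - by rewrite /dot /=; ring.
  - by move: D0; rewrite /dot /= => D0; lra.
have [c0|c0] := eqVneq (V c - V a) 0.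
  apply: (key (1, 0)); rewrite ?b0 ?c0 /dot /= ?mulr0 ?addr0//.
  by apply/eqP => -[/eqP]; rewrite oner_eq0.
apply: (key (- (V c - V a).2, (V c - V a).1)).
- exact: perp_neq0.
- by rewrite b0 /dot /= !mulr0 addr0.
- by rewrite /dot /=; ring.
Qed.

Lemma vertices_distinct T i j : #|T| = 3%N -> ~ collinear T ->
  i \in T -> j \in T -> i != j -> V i != V j.
Proof.
move=> T3 ncT iT jT ij.
have [a [b [c [eT u D]]]] := triangle_enum T3 ncT.
apply: contraNN D => /eqP Vij.
have memT k : (k \in T) = (k \in [:: a; b; c]) by rewrite -eT mem_enum.
move: iT jT; rewrite !memT !inE /cross /=.
move=> /or3P[]/eqP ei /or3P[]/eqP ej; move: ij Vij; rewrite ei ej ?eqxx// => _ ->;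
 apply/eqP; ring.
Qed.

(** Barycentric coordinates are affine functions of the point, by Cramer's rule.
    They provide the nodal basis of P_m(T), and they describe the triangle by
    three inequalities, which gives its measurability. *)
Lemma barycentric_polys T : #|T| = 3%N -> ~ collinear T ->
  exists L : 'I_n -> {poly {poly R}},
    [/\ forall i, tdeg_le 1 (L i),
        forall i w, weights T w -> eval2 (L i) (bary w) = w i &
        forall x, (forall i, i \in T -> 0 <= eval2 (L i) x) ->
          exists2 w, weights T w & x = bary w].
Proof.
move=> T3 ncT; have [a [b [c [eT u D]]]] := triangle_enum T3 ncT.
have memT i : (i \in T) = [|| i == a, i == b | i == c].
  by rewrite -mem_enum eT !inE.
(* The coordinates of x are the signed areas of the triangles formed by x and two of
   the vertices, relative to the one of T, expanded as affine functions of x. *)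
pose D0 := cross (V b - V a) (V c - V a).
pose Lb := affine_poly (- cross (V a) (V c - V a) / D0)
  ((V c - V a).2 / D0) (- (V c - V a).1 / D0).
pose Lc := affine_poly (- cross (V b - V a) (V a) / D0)
  (- (V b - V a).2 / D0) ((V b - V a).1 / D0).
pose La := affine_poly
  (1 + cross (V a) (V c - V a) / D0 + cross (V b - V a) (V a) / D0)
  (- (V c - V a).2 / D0 + (V b - V a).2 / D0)
  ((V c - V a).1 / D0 - (V b - V a).1 / D0).
pose L i := if i == a then La else if i == b then Lb else
            if i == c then Lc else affine_poly 0 0 0.
move: u; rewrite /= !inE negb_or andbT => /andP[/andP[ab ac] bc].
have ELa : L a = La by rewrite /L eqxx.
have ELb : L b = Lb by rewrite /L eq_sym (negbTE ab) eqxx.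
have ELc : L c = Lc.
  by rewrite /L eq_sym (negbTE ac) eq_sym (negbTE bc) eqxx.
have L1 x : eval2 La x + eval2 Lb x + eval2 Lc x = 1.
  by rewrite !eval2_affine /=; ring.
exists L; split.
- by move=> i; rewrite /L; repeat case: ifP => _; exact: tdeg_le_affine.
- move=> i w wP; have [_ wT w1] := wP.
  have [iT|iT] := boolP (i \in T); last first.
    rewrite wT// /L; move: iT; rewrite memT !negb_or => /and3P[].
    by do 3![move=> /negbTE ->]; rewrite eval2_affine !mul0r !addr0.
  have := bary_support wP; rewrite eT !big_cons big_nil addr0 => ->.
  move: w1; rewrite (@sum_support R T) ?eT ?big_cons ?big_nil// addr0 => w1.
  have -> : w i = if i == a then 1 - w b - w c else if i == b then w b else w c.
    move: iT; rewrite memT => /or3P[]/eqP ->.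
    - by rewrite eqxx; lra.
    - by rewrite eq_sym (negbTE ab) eqxx.
    - by rewrite eq_sym (negbTE ac) eq_sym (negbTE bc).
  have -> : w a = 1 - w b - w c by lra.
  move: iT; rewrite memT /L => /or3P[]/eqP ->.
  + rewrite eqxx eval2_affine /cross /=; move: D; rewrite -/D0.
    by rewrite /D0 /cross /= /GRing.scale /= => D; field.
  + rewrite eq_sym (negbTE ab) eqxx eval2_affine; move: D; rewrite -/D0.
    by rewrite /D0 /cross /= /GRing.scale /= => D; field.
  + rewrite eq_sym (negbTE ac) eq_sym (negbTE bc) eqxx eval2_affine; move: D.
    by rewrite /D0 /cross /= /GRing.scale /= => D; field.
- move=> x xL; exists (fun i => if i \in T then eval2 (L i) x else 0).
    split.
    + by move=> i; case: ifPn => // /xL.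
    + by move=> i /negbTE ->.
    + rewrite (@sum_support R T) => [|i /negbTE ->//].
      rewrite eT !big_cons big_nil addr0 !memT !eqxx ?orbT /=.
      by rewrite ELa ELb ELc addrA L1.
  rewrite /bary (@sum_support _ T) => [|i /negbTE ->]; last by rewrite scale0r.
  rewrite eT !big_cons big_nil addr0 !memT !eqxx ?orbT /= ELa ELb ELc.
  rewrite [LHS]surjective_pairing [RHS]surjective_pairing !eval2_affine.
  by move: D; rewrite /D0 /cross /= /GRing.scale /= => D; congr pair; field.
Qed.

(** The coordinates of the point are affine functions of the weights, so a monomial
    of total degree at most m is a product of at most m of them. *)
Lemma tri_poly_reproduced m T f : (0 < #|T|)%N -> tri_poly m T f ->
  reproduced m T (f \o bary).
Proof.
move=> T0 [p hp fp].
apply: (@degree_reproduced _ _ _ _ T0 m) => //.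
apply: (@eq_degree _ _ _ _ T0 _ (fun w => \sum_(i < size p) \sum_(j < size p`_i)
    p`_i`_j * ((\sum_k w k * (V k).1) ^+ i * ((\sum_k w k * (V k).2) ^+ j * 1)))).
  move=> w wP; rewrite /= fp; last by apply/hullP; exists w.
  rewrite eval2_coef; apply: eq_bigr => i _; apply: eq_bigr => j _.
  by rewrite bary1 bary2 mulr1.
apply: degree_sum => // i _; apply: degree_sum => // j _.
have [ij|ij] := leqP (i + j) m.
  apply: degreeZ => //; apply: (degree_le T0 ij); rewrite -[(_ + j)%N]addn0 -addnA.
  by do 2 apply: degree_affineX => //; exact: degree1.
rewrite hp//; apply: (@eq_degree _ _ _ _ T0 _ (fun w => 0 * 1)).
  by move=> w _; rewrite !mul0r.
by apply: degreeZ => //; apply: (@degree_le _ _ _ _ T0 0) => //; exact: degree1.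
Qed.

Lemma tri_poly_silvester m T (a : {ffun 'I_n -> 'I_m.+1}) :
  #|T| = 3%N -> ~ collinear T -> lattice T a ->
  exists2 f, tri_poly m T f &
    forall w, weights T w -> f (bary w) = silvester m (fun i => a i) w.
Proof.
move=> T3 ncT /latticeP[aT am].
have [L [L1 Lw _]] := barycentric_polys T3 ncT.
pose F i (l : nat) : {poly {poly R}} :=
  (m%:R%:P%:P * L i + (- l%:R)%:P%:P) * (((a i)%:R - l%:R)^-1)%:P%:P.
exists (eval2 (\prod_i \prod_(l < a i) F i l)).
  exists (\prod_i \prod_(l < a i) F i l) => //.
  rewrite -[X in tdeg_le X]am; apply: tdeg_le_prod => i.
  rewrite -{1}[nat_of_ord (a i)]card_ord -sum1_card; apply: tdeg_le_prod => l.
  rewrite -[1%N]addn0; apply: tdeg_leM (tdeg_leC _).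
  apply: tdeg_leD; last exact: tdeg_le_trans (tdeg_leC _).
  exact: (tdeg_leM (tdeg_leC _)).
move=> w wP; rewrite eval2_prod; apply: eq_bigr => i _.
rewrite eval2_prod; apply: eq_bigr => l _.
by rewrite eval2M eval2D eval2M !eval2C Lw.
Qed.

Lemma edge_enum E : #|E| = 2%N -> exists a b,
  [/\ enum E = [:: a; b], a != b, a \in E, b \in E & edge_src E = V a /\ edge_tgt E = V b].
Proof.
move=> E2; have := enum_uniq E; have := cardE E; rewrite E2.
have memE i : (i \in E) = (i \in enum E) by rewrite mem_enum.
rewrite /edge_src /edge_tgt; case: (enum E) memE => [|a [|b []]]// memE _ u.
exists a, b; split=> //; rewrite ?memE ?inE ?eqxx ?orbT//.
by move: u; rewrite /= inE andbT.
Qed.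

Lemma edge_bary E a b w : enum E = [:: a; b] -> edge_src E = V a ->
  edge_tgt E = V b -> weights E w ->
  [/\ w a = 1 - w b, 0 <= w b <= 1 & bary w = edge_pt E (w b)].
Proof.
move=> eE sE tE wP; have wb1 := weights_le1 b wP.
have := bary_support wP; rewrite eE !big_cons big_nil addr0 => bw.
have [w0 wE] := wP; rewrite (@sum_support R E)// eE !big_cons big_nil addr0 => w1.
have wa : w a = 1 - w b by lra.
split=> //; first by rewrite w0 wb1.
rewrite bw wa /edge_pt sE tE [LHS]surjective_pairing [RHS]surjective_pairing /=.
by congr pair; rewrite /GRing.scale /=; ring.
Qed.

Lemma edge_poly_reproduced m E f : #|E| = 2%N -> edge_poly m E f ->
  reproduced m E (f \o bary).
Proof.
move=> E2 [q sq fq]; have [a [b [eE ab aE bE [sE tE]]]] := edge_enum E2.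
have E0 : (0 < #|E|)%N by rewrite E2.
apply: (@degree_reproduced _ _ _ _ E0 m) => //.
apply: (@eq_degree _ _ _ _ E0 _ (fun w => \sum_(j < size q)
    q`_j * ((\sum_k w k * (k == b)%:R) ^+ j * 1))).
  move=> w wP; have [_ wb bw] := edge_bary eE sE tE wP.
  rewrite /= bw fq// horner_coef; apply: eq_bigr => i _.
  rewrite mulr1 (bigD1 b)//= eqxx big1 ?addr0 ?mulr1// => k /negbTE ->.
  by rewrite mulr0.
apply: degree_sum => // j _; apply: degreeZ => //.
apply: (@degree_le _ _ _ _ E0 (j + 0)%N).
  by rewrite addn0 -ltnS (leq_trans (ltn_ord j)).
by apply: degree_affineX => //; exact: degree1.
Qed.

Lemma size_prod_affine (I : Type) (s : seq I) (d : I -> nat) (F : I -> {poly R}) :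
  (forall i, (size (F i) <= (d i).+1)%N) ->
  (size (\prod_(i <- s) F i)%R <= (\sum_(i <- s) d i).+1)%N.
Proof.
move=> h; elim/big_rec2: _ => [|i p m _ hp]; first by rewrite size_poly1.
by apply: leq_trans (size_polyMleq _ _) _; have := h i; lia.
Qed.

(** Members of P_m(E) are functions on the plane: here the polynomial in the edge
    parameter is composed with the orthogonal projection on the edge. *)
Lemma edge_poly_silvester m E (a : {ffun 'I_n -> 'I_m.+1}) :
  #|E| = 2%N -> edge_src E != edge_tgt E -> lattice E a ->
  exists2 f, edge_poly m E f &
    forall w, weights E w -> f (bary w) = silvester m (fun i => a i) w.
Proof.
move=> E2 st /latticeP[aE am].
have [i0 [i1 [eE ii i0E i1E [sE tE]]]] := edge_enum E2.
pose d := edge_tgt E - edge_src E.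
have dd : dot d d != 0.
  apply: contra st => /eqP; rewrite /dot => d0.
  have d10 : d.1 = 0 by nra.
  have d20 : d.2 = 0 by nra.
  rewrite eq_sym -subr_eq0 -/d; apply/eqP.
  by rewrite [d]surjective_pairing d10 d20.
pose tau x := dot (x - edge_src E) d / dot d d.
have tauE t : tau (edge_pt E t) = t.
  by rewrite /tau /edge_pt -/d; move: dd; rewrite /dot /= /GRing.scale /= => dd; field.
pose L i : {poly R} := if i == i1 then 'X else if i == i0 then 1 - 'X else 0.
pose F i (l : nat) : {poly R} :=
  (m%:R%:P * L i + (- l%:R)%:P) * (((a i)%:R - l%:R)^-1)%:P.
have sL i : (size (L i) <= 2)%N.
  rewrite /L; case: ifP => _; first by rewrite size_polyX.
  case: ifP => _; last by rewrite size_poly0.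
  rewrite (leq_trans (size_polyD _ _))// size_polyN size_polyX size_poly1//.
exists (fun x => (\prod_i \prod_(l < a i) F i l).[tau x]).
  exists (\prod_i \prod_(l < a i) F i l) => [|t _]; last by rewrite tauE.
  rewrite -[X in (_ <= X.+1)%N]am; apply: size_prod_affine => i.
  rewrite -[X in (_ <= X.+1)%N]card_ord -sum1_card; apply: size_prod_affine => l.
  have s1 (c : R) : (size c%:P <= 1)%N := size_polyC_leq1 c.
  have s2 : (size (m%:R%:P * L i + (- l%:R)%:P)%R <= 2)%N.
    rewrite (leq_trans (size_polyD _ _))// geq_max mul_polyC.
    by rewrite (leq_trans (size_scale_leq _ _))//= (leq_trans (s1 _)).
  apply: leq_trans (size_polyMleq _ _) _.
  by rewrite -subn1 leq_subLR addnC; apply: leq_add; [exact: s1|exact: s2].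
move=> w wP; have [w0 wb ->] := edge_bary eE sE tE wP; rewrite tauE.
rewrite horner_prod; apply: eq_bigr => i _.
rewrite horner_prod; apply: eq_bigr => l _.
rewrite /F !(hornerM, hornerD, hornerC) /L; congr ((_ * _ + _) * _).
case: eqVneq => [->|ii1]; first by rewrite hornerX.
case: eqVneq => [->|ii0]; first by rewrite hornerD hornerC hornerN hornerX w0.
have [_ wE _] := wP; rewrite horner0 wE//.
by rewrite -mem_enum eE !inE negb_or ii0 ii1.
Qed.

Lemma hull_edge_pt E x : #|E| = 2%N -> hull E x <-> exists2 t, 0 <= t <= 1 & x = edge_pt E t.
Proof.
move=> E2; have [a [b [eE ab aE bE [sE tE]]]] := edge_enum E2; split.
  by case/hullP => w wP ->; have [_ wb ->] := edge_bary eE sE tE wP; exists (w b).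
move=> [t t01 ->]; apply/hullP.
pose w i : R := if i == b then t else if i == a then 1 - t else 0.
have wP : weights E w.
  have wE i : i \notin E -> w i = 0.
    rewrite -mem_enum eE !inE negb_or => /andP[/negbTE ia /negbTE ib].
    by rewrite /w ia ib.
  split=> //.
    move=> i; rewrite /w; case: ifP => _; first by lra.
    by case: ifP => _ //; lra.
  rewrite (@sum_support R E)// eE !big_cons big_nil addr0 /w eqxx (negbTE ab) eqxx.
  by lra.
exists w => //; have [_ _ ->] := edge_bary eE sE tE wP.
by rewrite /w eqxx.
Qed.

(** A bound on the Lebesgue constant of the lattice of order m on a simplex with k
    vertices. *)
Definition lebesgue_const (k m : nat) : R := (m.+1 ^ k * m ^ m)%N%:R.

Lemma interp_tri_dist m T v x d : #|T| = 3%N -> ~ collinear T -> hull T x ->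
  (forall y, hull T y -> `|v y - v x| <= d) ->
  `|interp_tri T m v x - v x| <= lebesgue_const 3 m * d.
Proof.
move=> T3 ncT Tx vd; have T0 : (0 < #|T|)%N by rewrite T3.
rewrite /lebesgue_const -T3; apply: interp_dist => //.
- by move=> f; exact: tri_poly_reproduced.
- by move=> a; exact: tri_poly_silvester.
Qed.

Lemma interp_edge_dist m E v x d : #|E| = 2%N -> edge_src E != edge_tgt E ->
  hull E x -> (forall y, hull E y -> `|v y - v x| <= d) ->
  `|interp_edge E m v x - v x| <= lebesgue_const 2 m * d.
Proof.
move=> E2 st Ex vd; have E0 : (0 < #|E|)%N by rewrite E2.
rewrite /lebesgue_const -E2; apply: interp_dist => //.
- by move=> f; exact: edge_poly_reproduced.
- by move=> a; exact: edge_poly_silvester.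
Qed.

(** The interpolant belongs to P also when some nodal function is the default value
    0 of the choice operator. *)
Lemma interp_mem (P : set (R * R -> R)) A m v :
  P (fun=> 0) -> (forall c f g, P f -> P g -> P (fun x => c * f x + g x)) ->
  P (interp P A m v).
Proof.
move=> P0 PD; rewrite /interp.
have Pn a : P (nodal_basis P A (m := m) a).
  by rewrite /nodal_basis; case: xgetP => [f _ []|].
pose F (x : R * R) (a : {ffun 'I_n -> 'I_m.+1}) := v (node A a) * nodal_basis P A a x.
suff Ps s : P (fun x => \sum_(a <- s | lattice A a) F x a) by exact: Ps.
elim: s => [|a s IH]; first by under eq_fun do rewrite big_nil.
under eq_fun do rewrite big_cons.
by case: (lattice A a) => //; exact: PD.
Qed.

Lemma interp_tri_poly m T v : tri_poly m T (interp_tri T m v).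
Proof.
apply: interp_mem => [|c f g [p hp fp] [q hq gq]].
  exists 0%:P%:P; first exact: tdeg_le_trans (tdeg_leC 0).
  by move=> x _; rewrite eval2C.
exists (c%:P%:P * p + q) => [|x Tx].
  by apply: tdeg_leD => //; rewrite -[m]add0n; apply: tdeg_leM (tdeg_leC c) hp.
by rewrite eval2D eval2M eval2C fp// gq.
Qed.

Lemma interp_edge_poly m E v : edge_poly m E (interp_edge E m v).
Proof.
apply: interp_mem => [|c f g [p hp fp] [q hq gq]].
  by exists 0 => [|t _]; rewrite ?size_poly0// horner0.
exists (c *: p + q) => [|t t01]; last by rewrite hornerD hornerZ fp// gq.
by rewrite (leq_trans (size_polyD _ _))// geq_max hq (leq_trans (size_scale_leq _ _)).
Qed.

End Elements.

(** * Derivatives of polynomials and oscillation bounds on triangles *)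

Section PolynomialCalculus.
Context {R : realType}.
Implicit Types (p q : {poly {poly R}}) (x y v : R * R).

Definition pderiv1 p : {poly {poly R}} := p^`().
Definition pderiv2 p : {poly {poly R}} := map_poly (@deriv R) p.

Lemma pderivC p : pderiv2 (pderiv1 p) = pderiv1 (pderiv2 p).
Proof.
apply/polyP => i; rewrite /pderiv1 /pderiv2 coef_map coef_deriv /= [in RHS]coef_deriv.
by rewrite coef_map /= derivMn.
Qed.

Lemma is_derive_fst x v : is_derive x v (fst : R * R -> R) v.1.
Proof.
have cf : continuous (fst : R * R -> R) by move=> ?; exact: cvg_fst.
have lf : linear (fst : R * R -> R) by [].
pose f : {linear (R * R)%type -> R^o} := HB.pack (fst : (R * R)%type -> R^o)
  (GRing.isLinear.Build _ _ _ _ _ lf).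
have df : differentiable f x by apply: linear_differentiable.
apply: DeriveDef; first exact: (@diff_derivable _ _ _ f).
by rewrite -[fst]/(f : R * R -> R) deriveE// diff_lin.
Qed.

Lemma is_derive_snd x v : is_derive x v (snd : R * R -> R) v.2.
Proof.
have cf : continuous (snd : R * R -> R) by move=> ?; exact: cvg_snd.
have lf : linear (snd : R * R -> R) by [].
pose f : {linear (R * R)%type -> R^o} := HB.pack (snd : (R * R)%type -> R^o)
  (GRing.isLinear.Build _ _ _ _ _ lf).
have df : differentiable f x by apply: linear_differentiable.
apply: DeriveDef; first exact: (@diff_derivable _ _ _ f).
by rewrite -[snd]/(f : R * R -> R) deriveE// diff_lin.
Qed.

Lemma is_derive_horner_snd (q : {poly R}) x v :
  is_derive x v (fun y : R * R => q.[y.2]) (v.2 * q^`().[x.2]).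
Proof.
elim/poly_ind: q => [|q c IH].
  rewrite deriv0 horner0 mulr0; under eq_fun do rewrite horner0.
  exact: is_derive_cst.
have -> : (fun y : R * R => (q * 'X + c%:P).[y.2]) =
    (fun y : R * R => q.[y.2]) * (snd : R * R -> R) + cst c.
  by apply/funext => y; rewrite !hornerE.
have H := is_derive_snd x v.
apply: is_derive_eq; rewrite derivD derivM derivX derivC !hornerE.
by rewrite /GRing.scale /=; ring.
Qed.

Lemma is_derive_eval2 p x v : is_derive x v (eval2 p)
  (v.1 * eval2 (pderiv1 p) x + v.2 * eval2 (pderiv2 p) x).
Proof.
rewrite /pderiv1 /pderiv2; elim/poly_ind: p => [|p c IH].
  have -> : eval2 0 = cst (0 : R).
    by apply/funext => y; rewrite /eval2 !horner0.
  rewrite deriv0 map_poly0 /eval2 !horner0 !mulr0 addr0; exact: is_derive_cst.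
have -> : eval2 (p * 'X + c%:P) =
    eval2 p * (fst : R * R -> R) + (fun y : R * R => c.[y.2]).
  by apply/funext => y; rewrite eval2D eval2M /eval2 hornerX !hornerC.
have H := is_derive_fst x v.
have K := is_derive_horner_snd c x v.
apply: is_derive_eq.
have -> : map_poly (@deriv R) (p * 'X + c%:P) =
    map_poly (@deriv R) p * 'X + (c^`())%:P.
  apply/polyP => i; rewrite coef_map /= !coefD derivD !coefMX !coefC.
  by case: i => [|i] /=; rewrite ?deriv0 ?coef_map.
rewrite derivD derivM derivX derivC !eval2D !eval2M.
rewrite /eval2 !hornerE /GRing.scale /= /eval2; ring.
Qed.

Lemma derive_eval2 p v x : 'D_v (eval2 p) x =
  v.1 * eval2 (pderiv1 p) x + v.2 * eval2 (pderiv2 p) x.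
Proof. by have := is_derive_eval2 p x v => ?; rewrite derive_val. Qed.

Lemma derive_e1_eval2 p : 'D_e1 (eval2 p) = eval2 (pderiv1 p).
Proof. by apply/funext => x; rewrite derive_eval2 mul1r mul0r addr0. Qed.

Lemma derive_e2_eval2 p : 'D_e2 (eval2 p) = eval2 (pderiv2 p).
Proof. by apply/funext => x; rewrite derive_eval2 mul1r mul0r add0r. Qed.

Lemma grad_eval2 p x : grad (eval2 p) x = (eval2 (pderiv1 p) x, eval2 (pderiv2 p) x).
Proof. by rewrite /grad -derive_e1_eval2 -derive_e2_eval2. Qed.

Lemma grad_eval2_deg0 p x : tdeg_le 0 p -> grad (eval2 p) x = 0.
Proof.
move=> hp; rewrite grad_eval2.
have -> : pderiv1 p = 0.
  apply/polyP => i; rewrite coef_deriv coef0; apply/polyP => j.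
  by rewrite coefMn hp ?addSn// mul0rn coef0.
have -> : pderiv2 p = 0.
  apply/polyP => i; rewrite coef_map /= coef0; apply/polyP => j.
  by rewrite coef_deriv hp ?addnS// mul0rn coef0.
by rewrite /eval2 !horner0.
Qed.

(** Along a line, the difference quotient of the restriction is the one that
    defines the directional derivative. *)
Lemma is_derive_line p x v (t : R) :
  is_derive t 1 (fun t => eval2 p (x + t *: v)) ('D_v (eval2 p) (x + t *: v)).
Proof.
have [dp _] := is_derive_eval2 p (x + t *: v) v.
have E : (fun h : R => h^-1 *: (((fun t => eval2 p (x + t *: v)) \o shift t) (h *: 1)
      - eval2 p (x + t *: v))) =
    (fun h : R => h^-1 *: ((eval2 p \o shift (x + t *: v)) (h *: v) - eval2 p (x + t *: v))).
  apply/funext => h /=; congr (_ *: (eval2 p _ - _)).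
  by rewrite [_ *: 1]mulr1 scalerDl addrCA.
by apply: DeriveDef; rewrite /derivable /derive E.
Qed.

Lemma measurable_eval2 p (D : set (R * R)) : measurable_fun D (eval2 p).
Proof.
rewrite (_ : eval2 p = fun x => \sum_(i < size p) \sum_(j < size p`_i)
   p`_i`_j * (x.1 ^+ i * x.2 ^+ j)); last by apply/funext => x; exact: eval2_coef.
apply: measurable_sum => i; apply: measurable_sum => j.
apply: measurable_funM => //; apply: measurable_funM; apply: measurable_funX.
- exact: (measurable_funS measurableT (@subsetT _ _) measurable_fst).
- exact: (measurable_funS measurableT (@subsetT _ _) measurable_snd).
Qed.

Lemma eval2_bounded p (B : R) : exists K : R, forall x,
  `|x.1| <= B -> `|x.2| <= B -> `|eval2 p x| <= K.
Proof.
exists (\sum_(i < size p) \sum_(j < size p`_i) `|p`_i`_j| * (B ^+ i * B ^+ j)).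
move=> x x1 x2; rewrite eval2_coef.
apply: le_trans (ler_norm_sum _ _ _) _; apply: ler_sum => i _.
apply: le_trans (ler_norm_sum _ _ _) _; apply: ler_sum => j _.
rewrite normrM ler_wpM2l// normrM !normrX.
by apply: ler_pM; rewrite ?exprn_ge0//; apply: lerXn2r; rewrite ?nnegrE// (le_trans _ x1).
Qed.

End PolynomialCalculus.

Section ElementBounds.
Context {R : realType} {M : mesh R}.
Local Notation n := (nvtx M).
Local Notation V := (@vtx R M).
Implicit Types (A T E : {set 'I_n}) (w : 'I_n -> R) (x y v : R * R).
Implicit Types (p q : {poly {poly R}}).

Lemma hull_convex A x y t : hull A x -> hull A y -> 0 <= t <= 1 ->
  hull A (x + t *: (y - x)).
Proof.
move=> /hullP[w [w0 wA w1] ->] /hullP[w' [w0' wA' w1'] ->] /andP[t0 t1].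
apply/hullP; exists (fun i => w i + t * (w' i - w i)).
  split.
  - by move=> i; have := w0 i; have := w0' i; nra.
  - by move=> i iA; rewrite wA// wA'// subrr mulr0 addr0.
  - by rewrite big_split/= -mulr_sumr sumrB w1 w1' subrr mulr0 addr0.
rewrite /bary -sumrB scaler_sumr -big_split/=; apply: eq_bigr => i _.
by rewrite scalerDl -scalerBl scalerA.
Qed.

Lemma hullS A (B : {set 'I_n}) : A \subset B -> hull A `<=` hull B.
Proof.
move=> /fintype.subsetP AB x [w [w0 wA w1 ->]]; exists w; split => // i iB.
by apply: wA; apply: contra iB; exact: AB.
Qed.

Lemma hull_coord_bound A : exists B : R, forall x, hull A x ->
  `|x.1| <= B /\ `|x.2| <= B.
Proof.
exists (\sum_i (`|(V i).1| + `|(V i).2|)) => x /hullP[w wP ->].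
have wc i c : `|w i * c| <= `|c|.
  have [w0 _ _] := wP; rewrite normrM (ger0_norm (w0 i)).
  by rewrite ler_piMl//; exact: weights_le1 wP.
rewrite bary1 bary2; split; apply: le_trans (ler_norm_sum _ _ _) _;
  by apply: ler_sum => i _; rewrite (le_trans (wc _ _))// ?lerDl ?lerDr.
Qed.

Lemma eval2_bounded_hull p A : exists K : R, forall x, hull A x -> `|eval2 p x| <= K.
Proof.
have [B HB] := hull_coord_bound A; have [K HK] := eval2_bounded p B.
by exists K => x /HB[]; exact: HK.
Qed.

(** The suprema are finite, hence bounds, because polynomials are bounded on the
    hull. *)
Lemma W2oo_bounds p T x : hull T x ->
  [/\ `|eval2 (pderiv1 (pderiv1 p)) x| <= W2oo (eval2 p) T,
      `|eval2 (pderiv2 (pderiv1 p)) x| <= W2oo (eval2 p) T &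
      `|eval2 (pderiv2 (pderiv2 p)) x| <= W2oo (eval2 p) T].
Proof.
move=> Tx.
have key q : `|eval2 q x| <= sup [set `|eval2 q y| | y in hull T].
  apply: ub_le_sup; last by exists x.
  by have [K HK] := eval2_bounded_hull q T; exists K => _ [y /HK ? <-].
rewrite /W2oo; split; rewrite !le_max; apply/orP.
- left; have := key (pderiv1 (pderiv1 p)).
  by rewrite -(derive_e1_eval2 (pderiv1 p)) -(derive_e1_eval2 p).
- right; apply/orP; left; have := key (pderiv2 (pderiv1 p)).
  by rewrite -(derive_e2_eval2 (pderiv1 p)) -(derive_e1_eval2 p).
- right; apply/orP; right; have := key (pderiv2 (pderiv2 p)).
  by rewrite -(derive_e2_eval2 (pderiv2 p)) -(derive_e2_eval2 p).
Qed.

Lemma W2oo_ge0 p T : (0 < #|T|)%N -> 0 <= W2oo (eval2 p) T.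
Proof.
move=> /card_gt0P[i iT]; have Ti : hull T (V i).
  apply/hullP; exists (fun j => (j == i)%:R); first split => //.
  - by move=> j jT; case: eqVneq => // ji; rewrite ji iT in jT.
  - by rewrite (bigD1 i)//= eqxx big1 ?addr0// => j /negbTE ->.
  rewrite /bary (bigD1 i)//= eqxx scale1r big1 ?addr0// => j /negbTE ->.
  by rewrite scale0r.
have [h _ _] := W2oo_bounds p Ti; exact: le_trans h.
Qed.

Lemma coord_le_enorm (u : R * R) : `|u.1| <= enorm u /\ `|u.2| <= enorm u.
Proof.
rewrite /enorm /dot -!sqrtr_sqr; split; apply: ler_wsqrtr; rewrite -!expr2.
- by rewrite lerDl sqr_ge0.
- by rewrite lerDr sqr_ge0.
Qed.

Lemma le_diam T i j : i \in T -> j \in T -> enorm (V i - V j) <= diam T.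
Proof.
move=> iT jT; rewrite /diam.
apply: le_trans (le_bigmax_cond _ _ iT).
exact: (le_bigmax_cond _ (fun j => enorm (V i - V j)) jT).
Qed.

Lemma diam_ge0 T : 0 <= diam T.
Proof. by rewrite /diam; apply: bigmax_ge_id. Qed.

(** A weighted average is as close to y as all the averaged values are. *)
Lemma weighted_dist A w (c : 'I_n -> R) (y d : R) : weights A w ->
  (forall i, i \in A -> `|c i - y| <= d) -> `|\sum_i w i * c i - y| <= d.
Proof.
move=> [w0 wA w1] h.
have yE : y = \sum_i w i * y by rewrite -mulr_suml w1 mul1r.
have dE : d = \sum_i w i * d by rewrite -mulr_suml w1 mul1r.
rewrite [X in _ - X]yE dE -sumrB; apply: le_trans (ler_norm_sum _ _ _) _.
apply: ler_sum => i _; rewrite -mulrBr normrM (ger0_norm (w0 i)).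
by have [iA|iA] := boolP (i \in A); [rewrite ler_wpM2l ?h|rewrite wA// !mul0r].
Qed.

Lemma hull_dist T x y : hull T x -> hull T y ->
  `|x.1 - y.1| <= diam T /\ `|x.2 - y.2| <= diam T.
Proof.
move=> /hullP[w wP ->] /hullP[w' wP' ->]; rewrite !bary1 !bary2; split.
- apply: (weighted_dist wP) => i iT; rewrite distrC; apply: (weighted_dist wP') => j jT.
  have [h _] := coord_le_enorm (V j - V i).
  exact: le_trans h (le_diam jT iT).
- apply: (weighted_dist wP) => i iT; rewrite distrC; apply: (weighted_dist wP') => j jT.
  have [_ h] := coord_le_enorm (V j - V i).
  exact: le_trans h (le_diam jT iT).
Qed.

(** Mean value theorem along the segment from x to y, which lies in the hull. *)
Lemma eval2_lipschitz_hull q T (K : R) x y :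
  (forall z, hull T z -> `|eval2 (pderiv1 q) z| <= K /\ `|eval2 (pderiv2 q) z| <= K) ->
  hull T x -> hull T y -> `|eval2 q y - eval2 q x| <= 2 * K * diam T.
Proof.
move=> HK Tx Ty.
pose v := y - x; pose f t := eval2 q (x + t *: v).
have df (t : R) : is_derive t (1 : R) f ('D_v (eval2 q) (x + t *: v)) by exact: is_derive_line.
have cf : {within `[0, 1], continuous f}.
  by apply: derivable_within_continuous => s _; have [] := df s.
have [t] := @MVT_segment R f _ 0 1 ler01 (fun t _ => df t) cf.
rewrite in_itv/= => t01; rewrite subr0 mulr1 {1 2}/f scale1r scale0r addr0.
rewrite (_ : x + v = y); last by rewrite /v addrC subrK.
move=> ->; rewrite derive_eval2.
have [k1 k2] := HK _ (hull_convex Tx Ty t01).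
have [d1 d2] := hull_dist Ty Tx.
apply: le_trans (ler_normD _ _) _; rewrite !normrM.
rewrite (_ : 2 * K * diam T = diam T * K + diam T * K); last by ring.
by apply: lerD; apply: ler_pM.
Qed.

End ElementBounds.

(** * Lipschitz continuity of the s-norm *)

Section VectorNorm.
Context {R : realType}.
Implicit Types (p b t d : R) (s : \bar R) (x y : R * R).

(** By convexity: x1 + d and x2 lie between x1 and x2 + d, with the same sum. *)
Lemma powR_exchange p (x1 x2 : R) d : 1 <= p -> 0 <= x1 -> x1 <= x2 -> 0 <= d ->
  (x1 + d) `^ p + x2 `^ p <= x1 `^ p + (x2 + d) `^ p.
Proof.
move=> p1 x10 x12 d0; have [dx|dx] := eqVneq (x2 + d - x1) 0.
  have -> : d = 0 by lra.
  by rewrite !addr0 lexx.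
have l0 : 0 < x2 + d - x1 by rewrite lt_neqAle eq_sym dx; lra.
(* x1 + d = (1 - t) x1 + t (x2 + d) and x2 = t x1 + (1 - t) (x2 + d). *)
pose t := d / (x2 + d - x1).
have t0 : 0 <= t by rewrite divr_ge0// ltW.
have t1 : t <= 1 by rewrite ler_pdivrMr// mul1r; lra.
have in0 z : 0 <= z -> z \in (`[0, +oo[%classic : set R).
  by move=> z0; rewrite inE /= in_itv /= z0.
have m1 : x1 \in (`[0, +oo[%classic : set R) by exact: in0.
have m2 : x2 + d \in (`[0, +oo[%classic : set R) by apply: in0; lra.
have : (t * (x2 + d) + (1 - t) * x1) `^ p <=
    t * (x2 + d) `^ p + (1 - t) * x1 `^ p := convex_powR p1 (Itv01 t0 t1) m2 m1.
have : (t * x1 + (1 - t) * (x2 + d)) `^ p <=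
    t * x1 `^ p + (1 - t) * (x2 + d) `^ p := convex_powR p1 (Itv01 t0 t1) m1 m2.
have -> : t * (x2 + d) + (1 - t) * x1 = x1 + d by rewrite /t; field.
have -> : t * x1 + (1 - t) * (x2 + d) = x2 by rewrite /t; field.
by lra.
Qed.

Lemma powRVK p t : 1 <= p -> 0 <= t -> (t `^ p) `^ p^-1 = t.
Proof. by move=> p1 t0; rewrite -powRrM mulfV ?powRr1// gt_eqF//; lra. Qed.

Lemma powRKV p t : 1 <= p -> 0 <= t -> (t `^ p^-1) `^ p = t.
Proof. by move=> p1 t0; rewrite -powRrM mulVf ?powRr1// gt_eqF//; lra. Qed.

(** With N the norm of (t, b), raising both sides to the power p turns the second
    inequality into [powR_exchange] at the points t <= N. *)
Lemma pnorm_incr p t d b : 1 <= p -> 0 <= t -> 0 <= d ->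
  (t `^ p + b `^ p) `^ p^-1 <= ((t + d) `^ p + b `^ p) `^ p^-1 <=
  (t `^ p + b `^ p) `^ p^-1 + d.
Proof.
move=> p1 t0 d0.
have p0 : 0 <= p by lra.
have ip0 : 0 <= p^-1 by rewrite invr_ge0.
have s0 : 0 <= t `^ p + b `^ p by rewrite addr_ge0 ?powR_ge0.
have s0' : 0 <= (t + d) `^ p + b `^ p by rewrite addr_ge0 ?powR_ge0.
apply/andP; split.
  apply: ge0_ler_powR; rewrite ?nnegrE// lerD2r.
  by apply: ge0_ler_powR; rewrite ?nnegrE//; lra.
set N := (t `^ p + b `^ p) `^ p^-1.
have N0 : 0 <= N by exact: powR_ge0.
have tN : t <= N.
  rewrite -[leLHS](powRVK p1 t0); apply: ge0_ler_powR; rewrite ?nnegrE ?powR_ge0//.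
  by rewrite lerDl powR_ge0.
have Np : N `^ p = t `^ p + b `^ p by rewrite powRKV.
rewrite -[leRHS](powRVK p1) ?addr_ge0//.
apply: ge0_ler_powR; rewrite ?nnegrE ?powR_ge0//.
by have := powR_exchange p1 t0 tN d0; rewrite Np; lra.
Qed.

Lemma pnorm_lip1 p t t' b : 1 <= p -> 0 <= t -> 0 <= t' ->
  `|(t `^ p + b `^ p) `^ p^-1 - (t' `^ p + b `^ p) `^ p^-1| <= `|t - t'|.
Proof.
move=> p1; wlog tt : t t' / t <= t'.
  move=> H t0 t0'; have [tt|/ltW tt] := leP t t'; first exact: H.
  by rewrite distrC (distrC t); exact: H.
move=> t0 t0'; have d0 : 0 <= t' - t by rewrite subr_ge0.
have := pnorm_incr b p1 t0 d0; rewrite (_ : t + (t' - t) = t') => [/andP[h1 h2]|]; last by ring.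
by rewrite distrC (distrC t) (ger0_norm d0) ger0_norm ?subr_ge0// lerBlDl.
Qed.

Lemma max_lipschitz (a b c d : R) :
  `|Num.max a b - Num.max c d| <= `|a - c| + `|b - d|.
Proof.
have h1 := ler_norm (a - c); have h2 := ler_norm (b - d).
have := ler_norm (c - a); rewrite distrC => h3.
have := ler_norm (d - b); rewrite distrC => h4.
have n1 := normr_ge0 (a - c); have n2 := normr_ge0 (b - d).
move: h1 h2 h3 h4 n1 n2; move: `|a - c| `|b - d| => e f h1 h2 h3 h4 n1 n2.
by apply/ler_normlP; case: (leP a b) => ab; case: (leP c d) => cd; split; lra.
Qed.

(** The two coordinates are changed one after the other. *)
Lemma snorm_lipschitz s x y : (1 <= s)%E ->
  `|snorm s x - snorm s y| <= `|x.1 - y.1| + `|x.2 - y.2|.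
Proof.
have dd (a b : R) : `| `|a| - `|b| | <= `|a - b| := ler_dist_dist a b.
case: s => [p|_|//]; last first.
  by apply: le_trans (max_lipschitz _ _ _ _) _; apply: lerD; exact: dd.
rewrite lee_fin /snorm => p1.
apply: le_trans (ler_distD ((`|y.1| `^ p + `|x.2| `^ p) `^ p^-1) _ _) _.
apply: lerD; first exact: le_trans (pnorm_lip1 _ p1 _ _) (dd _ _).
rewrite ![`|y.1| `^ p + _]addrC.
exact: le_trans (pnorm_lip1 _ p1 _ _) (dd _ _).
Qed.

Lemma snorm0 s : (1 <= s)%E -> snorm s (0 : R * R) = 0.
Proof.
case: s => [p|_|//]; rewrite /snorm /= ?normr0 ?maxxx//.
by rewrite lee_fin => p1; rewrite powR0 ?addr0 ?powR0// ?invr_eq0 gt_eqF//; lra.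
Qed.

Lemma snorm_le s x : (1 <= s)%E -> `|snorm s x| <= `|x.1| + `|x.2|.
Proof.
move=> s1; have := snorm_lipschitz x 0 s1.
by rewrite snorm0// !subr0.
Qed.

Lemma measurable_snorm (d : measure_display) (T : measurableType d) (D : set T) (f g : T -> R) s :
  measurable_fun D f -> measurable_fun D g ->
  measurable_fun D (fun z => snorm s (f z, g z)).
Proof.
move=> mf mg.
have mnf : measurable_fun D (fun z => `|f z|) by exact: measurableT_comp.
have mng : measurable_fun D (fun z => `|g z|) by exact: measurableT_comp.
case: s => [p| |]; rewrite /snorm /=; last exact: measurable_cst.
  apply: (measurableT_comp (measurable_powR _)).
  by apply: measurable_funD; apply: (measurableT_comp (measurable_powR _)).
exact: measurable_maxr.
Qed.

End VectorNorm.

(** * Null sets and the total area of the triangles *)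

Section PlaneMeasure.
Context {R : realType}.
Implicit Types (p q : {poly {poly R}}) (x y v w : R * R).
Local Notation mu2 := (@mu2 R).

Lemma measurable_eval2_ge0 p : measurable [set x : R * R | 0 <= eval2 p x].
Proof.
have -> : [set x : R * R | 0 <= eval2 p x] = setT `&` eval2 p @^-1` `[0, +oo[%classic.
  by rewrite setTI; apply/seteqP; split=> x /=; rewrite in_itv/= andbT.
exact: measurable_eval2.
Qed.

Lemma measurable_eval2_eq0 p : measurable [set x : R * R | eval2 p x = 0].
Proof.
have -> : [set x : R * R | eval2 p x = 0] = setT `&` eval2 p @^-1` [set 0].
  by rewrite setTI.
exact: measurable_eval2.
Qed.

(** Sections of a line along the second axis are single points, unless the line is
    parallel to this axis; then it is the product of a point and an axis. *)
Lemma line_null c (a b : R) : (a, b) != 0 ->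
  mu2 [set x : R * R | eval2 (affine_poly c a b) x = 0] = 0%E.
Proof.
have [b0|b0] := eqVneq b 0 => [a0|_]; last first.
  rewrite /mu2 /product_measure1 integral0_eq// => x _ /=.
  rewrite (_ : xsection _ _ = [set (- c - a * x) / b]) ?lebesgue_measure_set1//.
  apply/seteqP; split=> y; rewrite /xsection /= ?inE /= eval2_affine /=.
    by move=> e; apply: (mulIf b0); rewrite divfK//; lra.
  by move=> ->; field.
have {}a0 : a != 0.
  by apply: contra a0 => /eqP ->; rewrite b0.
rewrite (_ : [set x | _] = [set - c / a] `*` setT).
  rewrite /mu2 product_measure1E; try exact: measurable_set1; last exact: measurableT.
  by rewrite [X in (X * _)%E](lebesgue_measure_set1 _) mul0e.
apply/seteqP; split=> x /=; rewrite eval2_affine b0 mul0r addr0.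
  by move=> e; split=> //; apply: (mulIf a0); rewrite divfK//; lra.
by move=> [-> _]; field.
Qed.

(** The segment is cut out of its line by two half-planes, hence measurable; a
    segment reduced to a point is treated apart, as it spans no line. *)
Lemma segment_null v w : measurable (segment v w) /\ mu2 (segment v w) = 0%E.
Proof.
have [vw|vw] := eqVneq v w.
  have -> : segment v w = [set v.1] `*` [set v.2].
    apply/seteqP; split=> x; rewrite vw /segment /= subrr.
      by move=> [t _ ->]; rewrite scaler0 addr0.
    case: x => x1 x2 /= [-> ->]; exists 0; rewrite ?lexx ?ler01//.
    by rewrite scaler0 addr0 -surjective_pairing.
  split; first by apply: measurableX; exact: measurable_set1.
  rewrite /mu2 product_measure1E; try exact: measurable_set1.
  by rewrite [X in (X * _)%E](lebesgue_measure_set1 _) mul0e.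
pose d := w - v.
have dd : 0 < dot d d.
  rewrite lt_neqAle eq_sym andbC addr_ge0 -?expr2 ?sqr_ge0//=.
  apply: contra vw; rewrite /dot paddr_eq0 -?expr2 ?sqr_ge0// !expf_eq0 /=.
  by rewrite !subr_eq0 => /andP[/eqP h1 /eqP h2]; apply/eqP;
     rewrite [v]surjective_pairing [w]surjective_pairing h1 h2.
(* l vanishes on the line through v and w; p and q are nonnegative on the side of w
   from v, and on the side of v from w. *)
pose l := affine_poly (v.2 * d.1 - v.1 * d.2) d.2 (- d.1).
pose p := affine_poly (- dot v d) d.1 d.2.
pose q := affine_poly (dot w d) (- d.1) (- d.2).
have sE : segment v w =
    [set x | eval2 l x = 0] `&` [set x | 0 <= eval2 p x] `&` [set x | 0 <= eval2 q x].
  apply/seteqP; split=> x.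
    move=> [t /andP[t0 t1] ->]; rewrite -/d /= !eval2_affine /=.
    have -> : w = v + d by rewrite /d addrC subrK.
    move: dd; rewrite /dot /= /GRing.scale /= => dd.
    by split; [split|]; [ring | nra | nra].
  rewrite /= !eval2_affine => -[[l0 p0] q0].
  exists (dot (x - v) d / dot d d); last first.
    have dn0 : dot d d != 0 by rewrite gt_eqF.
    have l1 : d.2 * (x.1 - v.1) = d.1 * (x.2 - v.2) by lra.
    rewrite -/d [LHS]surjective_pairing [RHS]surjective_pairing /= /GRing.scale /=.
    have e1 : dot (x - v) d * d.1 = (x.1 - v.1) * dot d d.
      transitivity ((x.1 - v.1) * d.1 * d.1 + d.2 * (d.1 * (x.2 - v.2))).
        by rewrite /dot /=; ring.
      by rewrite -l1 /dot; ring.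
    have e2 : dot (x - v) d * d.2 = (x.2 - v.2) * dot d d.
      transitivity (d.1 * (d.2 * (x.1 - v.1)) + (x.2 - v.2) * d.2 * d.2).
        by rewrite /dot /=; ring.
      by rewrite l1 /dot; ring.
    by congr pair; rewrite mulrAC ?e1 ?e2 mulfK//; ring.
  move: p0 q0; have -> : w = v + d by rewrite /d addrC subrK.
  move=> p0 q0; rewrite divr_ge0 ?(ltW dd)//=; last by move: p0; rewrite /dot /=; lra.
  by rewrite ler_pdivrMr// mul1r; move: q0; rewrite /dot /=; lra.
have ml := measurable_eval2_eq0 l.
have ms : measurable (segment v w).
  by rewrite sE; do 2?[apply: measurableI => //; try exact: measurable_eval2_ge0].
have sl : segment v w `<=` [set x | eval2 l x = 0] by rewrite sE => x [[]].
split => //; apply: (subset_measure0 (mu := mu2) ms ml sl); apply: line_null.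
by apply: contraTN dd => /eqP[h1 /eqP]; rewrite oppr_eq0 => /eqP h2;
  rewrite /dot /= h1 h2 !mulr0 addr0 ltxx.
Qed.

Lemma segments_null (S : seq ((R * R) * (R * R))) :
  let D := [set x | exists2 c, c \in S & segment c.1 c.2 x] in
  measurable D /\ mu2 D = 0%E.
Proof.
elim: S => [|c S [mS nS]] /=.
  by rewrite (_ : [set x | _] = set0) ?measure0//; apply/seteqP; split=> x // [].
have [mc nc] := segment_null c.1 c.2.
rewrite (_ : [set x | _] = segment c.1 c.2 `|`
    [set x | exists2 c, c \in S & segment c.1 c.2 x]).
  split; first exact: measurableU.
  exact: etrans (measureU0 (mu := mu2) mc mS nS) nc.
apply/seteqP; split=> x /=.
  by move=> [e]; rewrite inE => /predU1P[->|eS] h; [left|right; exists e].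
by move=> [h|[e eS h]]; [exists c|exists e] => //; rewrite inE ?eqxx// eS orbT.
Qed.

Lemma measure_seq_disjoint (I : eqType) (s : seq I) (F : I -> set (R * R)) : uniq s ->
  (forall i, i \in s -> measurable (F i)) ->
  (forall i j, i \in s -> j \in s -> i != j -> F i `&` F j = set0) ->
  measurable [set x | exists2 i, i \in s & F i x] /\
  mu2 [set x | exists2 i, i \in s & F i x] = (\sum_(i <- s) mu2 (F i))%E.
Proof.
elim: s => [_ _ _|i s IH].
  by rewrite (_ : [set x | _] = set0) ?measure0 ?big_nil//;
    apply/seteqP; split=> x // [].
rewrite cons_uniq => /andP[is_ us] mF dF.
have mFs j : j \in s -> measurable (F j) by move=> js; apply: mF; rewrite inE js orbT.
have dFs j k : j \in s -> k \in s -> j != k -> F j `&` F k = set0.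
  by move=> js ks; apply: dF; rewrite inE ?js ?ks orbT.
have [mD nD] := IH us mFs dFs.
rewrite (_ : [set x | _] = F i `|` [set x | exists2 i, i \in s & F i x]); last first.
  apply/seteqP; split=> x /=.
    by move=> [e]; rewrite inE => /predU1P[->|eS] h; [left|right; exists e].
  by move=> [h|[e eS h]]; [exists i|exists e] => //; rewrite inE ?eqxx// eS orbT.
have mFi : measurable (F i) by apply: mF; rewrite inE eqxx.
split; first exact: measurableU.
rewrite big_cons -nD; apply: (measureU mu2) => //.
rewrite -subset0 => x [Fi [j js Fj]].
rewrite -(dF i j) ?inE ?eqxx ?js ?orbT//.
by apply: contraNneq is_ => ->.
Qed.

End PlaneMeasure.

Section MeshMeasure.
Context {R : realType} {M : mesh R}.
Local Notation n := (nvtx M).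
Local Notation V := (@vtx R M).
Local Notation mu2 := (@mu2 R).
Implicit Types (A T E : {set 'I_n}).

Lemma measurable_hull T : #|T| = 3%N -> ~ collinear T -> measurable (hull T).
Proof.
move=> T3 ncT; have [L [_ Lw Lh]] := barycentric_polys T3 ncT.
have -> : hull T = \bigcap_(i in [set i | i \in T]) [set x | 0 <= eval2 (L i) x].
  apply/seteqP; split=> x.
    by move=> /hullP[w wP ->] i _ /=; rewrite Lw//; case: wP.
  by move=> h; apply/hullP; apply: Lh => i iT; exact: h.
by apply: fin_bigcap_measurable => // i _; exact: measurable_eval2_ge0.
Qed.

Lemma bounded_measure_fin (D : set (R * R)) A : measurable D -> D `<=` hull A ->
  (mu2 D < +oo)%E.
Proof.
move=> mD DA; have [B HB] := hull_coord_bound A.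
pose I : set R := `[- B, B]%classic.
have mI : measurable I by exact: measurable_itv.
have DB : D `<=` I `*` I by move=> x /DA/HB[]; rewrite !ler_norml /I /= !in_itv.
have [k Ik] : exists k, @lebesgue_measure R I = k%:E.
  by rewrite /I lebesgue_measure_itv /=; case: ifP => _; [exists (B - - B)|exists 0].
have II : mu2 (I `*` I) = (k * k)%:E.
  by rewrite EFinM -Ik; exact: product_measure1E.
have IIfin : (mu2 (I `*` I) < +oo)%E by rewrite II ltry.
exact: le_lt_trans (le_measure mu2 (mem_set mD) (mem_set (measurableX mI mI)) DB) IIfin.
Qed.

(** Two triangles of the mesh meet in the hull of at most two vertices, hence in a
    null set. *)
Lemma hull_small_segment A x : (#|A| <= 2)%N -> hull A x ->
  exists a b, segment (V a) (V b) x.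
Proof.
move=> A2 /hullP[w wP ->]; have [w0 wA w1] := wP.
have wb := bary_support wP; move: w1; rewrite (@sum_support R M R A)//.
move: A2 wb; rewrite cardE; have wle b := weights_le1 b wP.
case: (enum A) => [|a [|b []]]// _.
- by rewrite !big_nil => _ /esym/eqP; rewrite oner_eq0.
- rewrite !big_cons !big_nil !addr0 => -> ->; exists a, a; exists 0; rewrite ?lexx ?ler01//.
  by rewrite scale0r addr0 scale1r.
- rewrite !big_cons !big_nil !addr0 => -> wab; exists a, b; exists (w b); rewrite ?w0 ?wle//.
  have -> : w a = 1 - w b by lra.
  rewrite [LHS]surjective_pairing [RHS]surjective_pairing /=.
  by congr pair; rewrite /GRing.scale /=; ring.
Qed.

(** Outside the null set N formed by the segments of the boundary and all the
    segments between vertices, the triangles are disjoint and contained in Omega: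
    they lie in the closure of Omega, and a point of the closure which is not in
    the open set Omega is on the boundary. *)
Lemma sum_area_le Omega : polygonal_domain Omega -> triangulates M Omega ->
  \sum_(T in cells M) area (hull T) <= area Omega.
Proof.
move=> [oO _ _ _ [S bS]] [c3 nc meet clO _].
have mh T : T \in cells M -> measurable (hull T).
  by move=> Tc; apply: measurable_hull; [exact: c3|exact: nc].
have mcl : measurable (closure Omega).
  rewrite clO (_ : [set x | _] = \bigcup_(T in [set T | T \in cells M]) hull T).
    by apply: fin_bigcup_measurable => // T; exact: mh.
  by apply/seteqP; split=> x [T Tc Tx]; exists T.
have [mb _] := segments_null S; rewrite -bS in mb.
have mO : measurable Omega.
  have -> : Omega = closure Omega `\` boundary Omega.
    have /interior_id oO' := oO.
    rewrite /boundary oO'; apply/seteqP; split=> x.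
      by move=> Ox; split; [exact: subset_closure|move=> []].
    by move=> [clx nb]; apply: contrapT => nOx; apply: nb.
  exact: measurableD.
have clT : closure Omega `<=` hull [set: 'I_n]%SET.
  by rewrite clO => x [T _]; apply: hullS; exact: finset.subsetT.
have finO : (mu2 Omega < +oo)%E.
  by apply: bounded_measure_fin mO _; apply: subset_trans clT; exact: subset_closure.
(* The segments of the boundary, and the segments between any two vertices. *)
pose S' := S ++ [seq (V a, V b) | a <- enum 'I_n, b <- enum 'I_n].
have [mN N0] := segments_null S'; set N := (X in measurable X) in mN N0.
have bN : boundary Omega `<=` N.
  by rewrite bS => x [c cS h]; exists c => //; rewrite mem_cat cS.
have hN A : (#|A| <= 2)%N -> hull A `<=` N.
  move=> A2 x /(hull_small_segment A2)[a [b h]]; exists (V a, V b) => //.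
  rewrite mem_cat; apply/orP; right; apply/allpairsP; exists (a, b).
  by rewrite !mem_enum.
pose F T := hull T `\` N.
have mF T : T \in enum (cells M) -> measurable (F T).
  by rewrite mem_enum => /mh ?; exact: measurableD.
have dF T T' : T \in enum (cells M) -> T' \in enum (cells M) -> T != T' ->
    F T `&` F T' = set0.
  rewrite !mem_enum => Tc Tc' TT'; rewrite -subset0 => x [[Tx nx] [Tx' _]].
  apply: nx; apply: (hN (T :&: T')); last by rewrite -meet.
  rewrite -ltnS -(c3 _ Tc); apply: proper_card; rewrite finset.properEneq finset.subsetIl andbT.
  apply: contra TT' => /eqP/finset.setIidPl; rewrite eqEcard => ->.
  by rewrite (c3 _ Tc) (c3 _ Tc').
have [mU EU] := measure_seq_disjoint (enum_uniq _) mF dF.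
rewrite /area -lee_fin fineK; last by rewrite ge0_fin_numE.
rewrite -sumEFin.
apply: (@le_trans _ _ (\sum_(T <- enum (cells M)) mu2 (hull T `\` N))%E).
  rewrite big_enum/=; apply: lee_sum => T Tc; rewrite fineK; last first.
    rewrite ge0_fin_numE//; apply: bounded_measure_fin (mh _ Tc) _.
    exact: subset_refl.
  have mTN : measurable (hull T `\` N) by apply: measurableD => //; exact: mh.
  rewrite -[leRHS](measureU0 (mu := mu2) mTN mN N0).
  apply: (le_measure mu2); rewrite ?inE; [exact: mh| |].
    exact: measurableU.
  by move=> x Tx; have [Nx|Nx] := pselect (N x); [right|left].
rewrite -EU; apply: (le_measure mu2); rewrite ?inE//.
move=> x [T]; rewrite mem_enum => Tc [Tx nNx].
apply: contrapT => nOx; apply/nNx/bN; split; last by move=> /interior_subset.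
by rewrite clO; exists T.
Qed.

End MeshMeasure.

(** * Local errors *)

Section IntegralComparison.
Context {R : realType}.

(** Integrability of g is a consequence of the bounds on f and on f - g. *)
Lemma Rintegral_dist (d : measure_display) (T : measurableType d)
    (mu : {measure set T -> \bar R}) (D : set T) (f g : T -> R) (K B : R) :
  measurable D -> (mu D < +oo)%E -> measurable_fun D f -> measurable_fun D g ->
  (forall x, D x -> `|f x| <= B) -> (forall x, D x -> `|f x - g x| <= K) ->
  `|\int[mu]_(x in D) f x - \int[mu]_(x in D) g x| <= K * fine (mu D).
Proof.
move=> mD fD mf mg fB fgK.
have bounded_int (h : T -> R) (b : R) : measurable_fun D h -> (forall x, D x -> `|h x| <= b) ->
    mu.-integrable D (EFin \o h).
  move=> mh hb; apply: measurable_bounded_integrable => //.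
  exists b; split; first exact: num_real.
  by move=> c bc x Dx; exact: le_trans (hb x Dx) (ltW bc).
have fI : mu.-integrable D (EFin \o f) by exact: bounded_int fB.
have gI : mu.-integrable D (EFin \o g).
  apply: (bounded_int _ (B + K)) => // x Dx.
  rewrite (_ : g x = f x - (f x - g x)); last by ring.
  by apply: le_trans (ler_normB _ _) _; apply: lerD; [exact: fB|exact: fgK].
have mfg : measurable_fun D (fun x => f x - g x) by exact: measurable_funB.
have fgI : mu.-integrable D (EFin \o (fun x => f x - g x)) by exact: bounded_int fgK.
rewrite -RintegralB//; apply: le_trans (le_normr_Rintegral mD fgI) _.
rewrite -Rintegral_cst//; apply: le_Rintegral => //.
- by apply: (bounded_int _ K); [exact: measurableT_comp|move=> x /fgK; rewrite normr_id].
- by apply: (bounded_int _ `|K|) => //.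
Qed.

End IntegralComparison.

Section LocalErrors.
Context {R : realType} {M : mesh R}.
Local Notation n := (nvtx M).
Local Notation V := (@vtx R M).
Implicit Types (A T E : {set 'I_n}) (s : \bar R) (p : {poly {poly R}}).

(** Each component of the gradient oscillates by at most 2 W2oo diam on T, where
    the factor 2 counts the coordinates of the displacement; the s-norm adds the
    oscillations of the two components. *)
Lemma tri_error m s T p : (1 <= s)%E -> #|T| = 3%N -> ~ collinear T ->
  `|tri_int T (fun x => snorm s (grad (eval2 p) x)) -
    tri_int T (interp_tri T m (fun x => snorm s (grad (eval2 p) x)))| <=
  lebesgue_const 3 m * (4 * W2oo (eval2 p) T * diam T) * area (hull T).
Proof.
move=> s1 T3 ncT; have mT := measurable_hull T3 ncT.
have [K1 HK1] := eval2_bounded_hull (pderiv1 p) T.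
have [K2 HK2] := eval2_bounded_hull (pderiv2 p) T.
set v := fun x => _.
have vE : v = fun x => snorm s (eval2 (pderiv1 p) x, eval2 (pderiv2 p) x).
  by apply/funext => x; rewrite /v grad_eval2.
have [q _ qE] := interp_tri_poly m T v.
apply: (@Rintegral_dist _ _ _ (@mu2 R) _ _ _ _ (K1 + K2)) => //.
- exact: bounded_measure_fin mT (@subset_refl _ _).
- by rewrite vE; apply: measurable_snorm; exact: measurable_eval2.
- apply: (eq_measurable_fun (eval2 q)); last exact: measurable_eval2.
  by move=> x; rewrite inE => /qE.
- move=> x Tx; rewrite vE; apply: le_trans (snorm_le _ s1) _ => /=.
  by apply: lerD; [exact: HK1|exact: HK2].
move=> x Tx; rewrite distrC; apply: interp_tri_dist => // y Ty.
rewrite vE; apply: le_trans (snorm_lipschitz _ _ s1) _ => /=.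
have h1 : `|eval2 (pderiv1 p) y - eval2 (pderiv1 p) x| <=
    2 * W2oo (eval2 p) T * diam T.
  by apply: eval2_lipschitz_hull => // z /(W2oo_bounds p)[].
have h2 : `|eval2 (pderiv2 p) y - eval2 (pderiv2 p) x| <=
    2 * W2oo (eval2 p) T * diam T.
  by apply: eval2_lipschitz_hull => // z /(W2oo_bounds p)[]; rewrite -pderivC.
by lra.
Qed.

Lemma derivable_line p (x v : R * R) (t : R) :
  derivable (fun t : R => eval2 p (x + t *: v)) t 1.
Proof. by have [] := is_derive_line p x v t. Qed.

Lemma continuous_line p (x v : R * R) : continuous (fun t : R => eval2 p (x + t *: v)).
Proof.
by move=> t; apply/differentiable_continuous/derivable1_diffP/derivable_line.
Qed.

Definition dir_deriv (v : R * R) p : {poly {poly R}} :=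
  v.1%:P%:P * pderiv1 p + v.2%:P%:P * pderiv2 p.

Lemma derive_dir_deriv (v : R * R) p x : 'D_v (eval2 p) x = eval2 (dir_deriv v p) x.
Proof. by rewrite derive_eval2 eval2D !eval2M !eval2C. Qed.

(** Fundamental theorem of calculus between a and b, followed by an enlargement of
    the domain of integration. *)
Lemma line_variation p (x v : R * R) (a b : R) : 0 <= a <= 1 -> 0 <= b <= 1 ->
  `|eval2 p (x + b *: v) - eval2 p (x + a *: v)| <=
  \int[@lebesgue_measure R]_(t in `[0, 1]%classic) `|'D_v (eval2 p) (x + t *: v)|.
Proof.
wlog ab : a b / a < b.
  move=> H a01 b01; have [ab|ba|->] := ltgtP a b.
  - exact: H.
  - by rewrite distrC; exact: H.
  - by rewrite subrr normr0; apply: Rintegral_ge0.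
move=> /andP[a0 a1] /andP[b0 b1].
under eq_Rintegral do rewrite derive_dir_deriv.
pose g' t := eval2 (dir_deriv v p) (x + t *: v).
have cg' : continuous g' by exact: continuous_line.
have mg : measurable_fun setT g' by exact: continuous_measurable_fun.
have mng : measurable_fun setT (fun t => `|g' t|) by exact: measurableT_comp.
have ig : (@lebesgue_measure R).-integrable `[0, 1] (EFin \o g').
  apply: continuous_compact_integrable; first exact: segment_compact.
  exact: continuous_subspaceT.
have ftc : (\int[lebesgue_measure]_(t in `[a, b]) (g' t)%:E =
    (eval2 p (x + b *: v))%:E - (eval2 p (x + a *: v))%:E)%E.
  apply: (@continuous_FTC2 R g' (fun t => eval2 p (x + t *: v))) => //.
  - exact: continuous_subspaceT.
  - split.
    + by move=> t _; exact: derivable_line.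
    + by apply: cvg_at_right_filter; exact: continuous_line.
    + by apply: cvg_at_left_filter; exact: continuous_line.
  - move=> t _; rewrite derive1E; have := is_derive_line p x v t => ?.
    by rewrite derive_val derive_dir_deriv.
rewrite -lee_fin /Rintegral fineK; last first.
  by apply: integrable_fin_num => //; exact: integrable_norm ig.
rewrite -[X in (X <= _)%E]abse_EFin EFinB -ftc.
apply: le_trans (le_abse_integral _ _ _) _ => //.
  by apply/measurable_EFinP; apply: measurable_funTS.
apply: ge0_subset_integral => //=.
- by apply/measurable_EFinP; apply: measurable_funTS.
- by move=> t /=; rewrite !in_itv /= => /andP[ta tb]; apply/andP; split; lra.
Qed.

(** The factor 2 bounds the s-norm of the unit vector nu.  The derivative with
    respect to the parameter of the edge is its length times the tangential
    derivative, so the integral over the parameter is the L^1 norm on the edge. *)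
Lemma edge_error m s E p (nu : R * R) : (1 <= s)%E -> enorm nu = 1 ->
  #|E| = 2%N -> edge_src E != edge_tgt E ->
  `|edge_int E (fun x => `|eval2 p x| * snorm s nu) -
    edge_int E (interp_edge E m (fun x => `|eval2 p x| * snorm s nu))| <=
  edge_length E * (2 * lebesgue_const 2 m *
    edge_int E (fun x => `|'D_(edge_tangent E) (eval2 p) x|)).
Proof.
move=> s1 nu1 E2 st.
set v := fun x => _.
pose d := edge_tgt E - edge_src E.
have L0 : 0 < edge_length E.
  rewrite lt_neqAle eq_sym sqrtr_ge0 andbT.
  apply: contra st => /eqP L0; rewrite eq_sym -subr_eq0 -/d.
  have [] := coord_le_enorm d; rewrite -[enorm d]/(edge_length E) L0 !normr_le0.
  by move=> /eqP d1 /eqP d2; rewrite [d]surjective_pairing d1 d2.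
have ns : `|snorm s nu| <= 2.
  have [] := coord_le_enorm nu; rewrite nu1 => n1 n2.
  by apply: le_trans (snorm_le _ s1) _; lra.
set I := edge_int E (fun x => `|'D_(edge_tangent E) (eval2 p) x|).
have IE : I = \int[@lebesgue_measure R]_(t in `[0, 1]%classic)
    `|'D_d (eval2 p) (edge_src E + t *: d)|.
  have dE : d = edge_length E *: edge_tangent E.
    by rewrite /edge_tangent scalerA divff ?scale1r// gt_eqF.
  rewrite /I /edge_int -RintegralZl//.
    apply: eq_Rintegral => t _; rewrite -[X in X * _](gtr0_norm L0) -normrM.
    have d1 : d.1 = edge_length E * (edge_tangent E).1 by rewrite {1}dE.
    have d2 : d.2 = edge_length E * (edge_tangent E).2 by rewrite {1}dE.
    by congr `|_|; rewrite !derive_eval2 d1 d2 /edge_pt -/d; ring.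
  apply: continuous_compact_integrable; first exact: segment_compact.
  apply: continuous_subspaceT => t.
  rewrite (_ : (fun _ => _) = Num.norm \o
      (fun t => eval2 (dir_deriv (edge_tangent E) p) (edge_src E + t *: d))).
    by apply: continuous_comp; [exact: continuous_line|exact: norm_continuous].
  by apply/funext => z /=; rewrite derive_dir_deriv.
have I0 : 0 <= I by rewrite IE; exact: Rintegral_ge0.
have osc x y : hull E x -> hull E y -> `|eval2 p y - eval2 p x| <= I.
  move=> /(hull_edge_pt _ E2)[a a01 ->] /(hull_edge_pt _ E2)[b b01 ->].
  by rewrite IE; exact: line_variation.
have [B HB] := eval2_bounded_hull p E.
have hE t : 0 <= t <= 1 -> hull E (edge_pt E t).
  by move=> t01; apply/(hull_edge_pt _ E2); exists t.
have [q _ qE] := interp_edge_poly m E v.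
rewrite /edge_int -mulrBr normrM (gtr0_norm L0) ler_pM2l//.
have mu01 : @lebesgue_measure R `[0, 1]%classic = 1%:E.
  by rewrite lebesgue_measure_itv /= lte_fin ltr01 oppr0 adde0.
apply: (@le_trans _ _ (2 * lebesgue_const 2 m * I *
    fine (@lebesgue_measure R `[0, 1]%classic))); last by rewrite mu01 /= mulr1.
apply: (@Rintegral_dist _ _ _ _ _ _ _ _ (B * 2)) => //.
- by rewrite [X in (X < _)%E]mu01 ltry.
- apply: measurable_funTS; apply: measurable_funM => //.
  apply: measurableT_comp => //; apply: continuous_measurable_fun.
  exact: continuous_line.
- apply: (eq_measurable_fun (horner q)).
    by move=> t; rewrite inE /= in_itv /= => /qE.
  apply: measurable_funTS; apply: continuous_measurable_fun.
  exact: continuous_horner.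
- move=> t /=; rewrite in_itv /= => /hE/HB h.
  by rewrite /v normrM normr_id; apply: ler_pM.
move=> t /=; rewrite in_itv /= => /hE Et; rewrite distrC.
rewrite (_ : 2 * _ * _ = lebesgue_const 2 m * (I * 2)); last by ring.
apply: interp_edge_dist => // y Ey; rewrite /v -mulrBl normrM.
apply: ler_pM => //; apply: le_trans (osc _ _ Et Ey).
exact: ler_dist_dist.
Qed.

End LocalErrors.

(** * Summation over the mesh *)

Section GlobalEstimate.
Context {R : realType} (M : mesh R).
Local Notation n := (nvtx M).
Implicit Types (T E : {set 'I_n}) (s : \bar R) (Omega : set (R * R)).

Lemma le_mesh_size T : T \in cells M -> diam T <= mesh_size M.
Proof. by move=> Tc; rewrite /mesh_size; exact: (le_bigmax_cond _ (fun T => diam T) Tc). Qed.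

Lemma mesh_size_ge0 : 0 <= mesh_size M.
Proof. exact: bigmax_ge_id. Qed.

Lemma le_max_W2oo r u T : T \in cells M -> W2oo (restr r u T) T <= max_W2oo M r u.
Proof.
by move=> Tc; exact: (le_bigmax_cond _ (fun T => W2oo (restr r u T) T) Tc).
Qed.

Lemma max_W2oo_ge0 r u : 0 <= max_W2oo M r u.
Proof. exact: bigmax_ge_id. Qed.

Lemma area_ge0 (D : set (R * R)) : 0 <= area D.
Proof. by rewrite /area fine_ge0. Qed.

(** For r = 0 the triangle terms are absent from the discrete seminorm, and they
    vanish in the continuous one. *)
Lemma grad_restr0 u T x : grad (restr 0 u T) x = 0.
Proof.
apply: grad_eval2_deg0; case: xgetP => [p -> []//|_].
exact: (tdeg_leC 0).
Qed.

(** The jump is a linear combination of the polynomials of the adjacent triangles,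
    so its restriction to E is smooth. *)
Lemma jump_poly (nE : {set 'I_n} -> R * R) r u E :
  exists p, jump nE r u E = eval2 p.
Proof.
exists (\sum_(T in cells M | E \subset T)
  (dot (outer_normal T E) (nE E))%:P%:P * xget 0 (restr_of r u T)).
apply/funext => x; rewrite /jump /dot fst_sum snd_sum eval2_sum !mulr_suml -big_split/=.
apply: eq_bigr => T _; rewrite eval2M eval2C /restr /dot /GRing.scale /=; ring.
Qed.

Lemma edge_nondegenerate Omega E : triangulates M Omega -> is_edge E ->
  [/\ #|E| = 2%N, edge_src E != edge_tgt E & edge_length E <= mesh_size M].
Proof.
move=> [c3 nc _ _ _] [E2 [T Tc ET]].
have [a [b [eE ab aE bE [sE tE]]]] := edge_enum E2.
have inT i : i \in E -> i \in T by move/fintype.subsetP: ET; apply.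
split=> //.
  rewrite sE tE; apply: (vertices_distinct (c3 _ Tc) (nc _ Tc)) => //; exact: inT.
apply: le_trans (le_mesh_size Tc).
by rewrite /edge_length sE tE; apply: le_diam; exact: inT.
Qed.

Lemma jump_deriv_L1_ge0 (nE : {set 'I_n} -> R * R) r u E : 0 <= jump_deriv_L1 nE r u E.
Proof.
by rewrite /jump_deriv_L1 /edge_int mulr_ge0 ?sqrtr_ge0//; apply: Rintegral_ge0.
Qed.

Lemma triangle_terms_error Omega s m u : (1 <= s)%E ->
  polygonal_domain Omega -> triangulates M Omega ->
  `|\sum_(T in cells M) tri_int T (fun x => snorm s (grad (restr m.+1 u T) x)) -
    \sum_(T in cells M)
      tri_int T (interp_tri T m (fun x => snorm s (grad (restr m.+1 u T) x)))| <=
  4 * lebesgue_const 3 m * area Omega * mesh_size M * max_W2oo M m.+1 u.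
Proof.
move=> s1 polyO triO; have [c3 nc _ _ _] := triO.
have sumA := sum_area_le polyO triO.
have Lam0 : 0 <= lebesgue_const 3 m :> R by exact: ler0n.
have h0 := mesh_size_ge0; have W0 := max_W2oo_ge0 m.+1 u.
rewrite -sumrB; apply: le_trans (ler_norm_sum _ _ _) _.
pose c := 4 * lebesgue_const 3 m * mesh_size M * max_W2oo M m.+1 u.
have c0 : 0 <= c by rewrite /c !mulr_ge0.
apply: (@le_trans _ _ (\sum_(T in cells M) c * area (hull T))); last first.
  rewrite -mulr_sumr (_ : _ * max_W2oo M m.+1 u = c * area Omega).
    by rewrite ler_wpM2l.
  by rewrite /c; ring.
apply: ler_sum => T Tc; apply: le_trans (tri_error _ _ s1 (c3 _ Tc) (nc _ Tc)) _.
rewrite ler_wpM2r ?area_ge0// (_ : c = lebesgue_const 3 m *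
    (4 * max_W2oo M m.+1 u * mesh_size M)); last by rewrite /c; ring.
rewrite ler_wpM2l// ler_pM ?diam_ge0 ?le_mesh_size//.
  by rewrite mulr_ge0 ?W2oo_ge0// c3.
by rewrite ler_wpM2l// le_max_W2oo.
Qed.

Lemma edge_terms_error Omega s (nE : {set 'I_n} -> R * R) r u : (1 <= s)%E ->
  triangulates M Omega ->
  (forall E, interior_edge Omega E -> unit_normal E (nE E)) ->
  `|\sum_(E | `[< interior_edge Omega E >])
      edge_int E (fun x => `|jump nE r u E x| * snorm s (nE E)) -
    \sum_(E | `[< interior_edge Omega E >])
      edge_int E (interp_edge E r (fun x => `|jump nE r u E x| * snorm s (nE E)))| <=
  2 * lebesgue_const 2 r * mesh_size M *
    \sum_(E | `[< interior_edge Omega E >]) jump_deriv_L1 nE r u E.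
Proof.
move=> s1 triO nEP; rewrite -sumrB; apply: le_trans (ler_norm_sum _ _ _) _.
rewrite mulr_sumr; apply: ler_sum => E /asboolP EO.
have [nE1 _] := nEP _ EO; have [isE _] := EO.
have [E2 st hE] := edge_nondegenerate triO isE.
have jd0 := jump_deriv_L1_ge0 nE r u E.
have [p jp] := jump_poly nE r u E.
move: jd0; rewrite /jump_deriv_L1 jp => jd0.
apply: le_trans (edge_error _ _ s1 nE1 E2 st) _.
rewrite (_ : 2 * lebesgue_const 2 r * mesh_size M * _ = mesh_size M *
  (2 * lebesgue_const 2 r * edge_int E (fun x => `|'D_(edge_tangent E) (eval2 p) x|)));
  last by ring.
have Lam0 : 0 <= lebesgue_const 2 r :> R by exact: ler0n.
apply: ler_wpM2r hE; apply: mulr_ge0 jd0.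
exact: mulr_ge0.
Qed.

End GlobalEstimate.

Theorem proposition3p4 (R : realType) :
  exists C : nat -> \bar R -> R -> R -> R,
    (forall r s gamma A, 0 < C r s gamma A) /\
    forall (r : nat) (s : \bar R) (Omega : set (R * R)) (M : mesh R)
      (nE : {set 'I_(nvtx M)} -> R * R) (u : R * R -> R),
    (r <= 4)%N -> (1 <= s)%E ->
    polygonal_domain Omega -> triangulates M Omega ->
    (forall E : {set 'I_(nvtx M)}, interior_edge Omega E -> unit_normal E (nE E)) ->
    DG M Omega r u ->
    `|TV Omega s nE r u - DTV Omega s nE r u| <=
      C r s (max_aspect M) (area Omega) * mesh_size M *
      (max_W2oo M r u +
       \sum_(E | `[< interior_edge Omega E >]) jump_deriv_L1 nE r u E).
Proof.
have Lam0 k m : 0 <= lebesgue_const k m :> R by exact: ler0n.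
exists (fun r _ _ A => 4 * lebesgue_const 3 r.-1 * `|A| + 2 * lebesgue_const 2 r).
split=> [r s gamma A|r s Omega M nE u _ s1 polyO triO nEP _].
  rewrite ltr_wpDl ?mulr_ge0// mulr_gt0// ltr0n muln_gt0 !expn_gt0 /=.
  by case: r.
have Te : `|\sum_(T in cells M) tri_int T (fun x => snorm s (grad (restr r u T) x)) -
    (if r is m.+1 then \sum_(T in cells M)
       tri_int T (interp_tri T m (fun x => snorm s (grad (restr r u T) x)))
     else 0)| <=
    4 * lebesgue_const 3 r.-1 * area Omega * mesh_size M * max_W2oo M r u.
  case: r => [|m]; last exact: triangle_terms_error.
  rewrite subr0 big1 ?normr0; last first.
    move=> T _; rewrite /tri_int /Rintegral integral0_eq// => x _.
    by rewrite grad_restr0 snorm0.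
  by rewrite !mulr_ge0 ?area_ge0 ?mesh_size_ge0 ?max_W2oo_ge0.
have Ee := edge_terms_error r u s1 triO nEP.
have J0 : 0 <= \sum_(E | `[< interior_edge Omega E >]) jump_deriv_L1 nE r u E.
  by apply: sumr_ge0 => E _; exact: jump_deriv_L1_ge0.
have W0 := max_W2oo_ge0 M r u; have h0 := mesh_size_ge0 M.
rewrite (ger0_norm (area_ge0 Omega)) /TV /DTV opprD addrACA.
apply: le_trans (ler_normD _ _) _; apply: le_trans (lerD Te Ee) _.
set K3 := 4 * _ * _; set K2 := 2 * lebesgue_const 2 r.
have K30 : 0 <= K3 by rewrite !mulr_ge0 ?area_ge0.
have K20 : 0 <= K2 by rewrite mulr_ge0.
rewrite mulrDr; apply: lerD.
  by rewrite ler_wpM2r// ler_wpM2r// lerDl.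
by rewrite ler_wpM2r// ler_wpM2r// lerDr.
Qed.
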